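(* Let $E$ be a Banach lattice in which every order interval is a limited set. Then the following hold. (i) For every Banach space $Y$, every weakly compact operator $T:E\to Y$ is AM-compact. (ii) For every Banach space $Y$, every order weakly compact operator $T:E\to Y$ is AM-compact. (iii) If $F$ is a Banach lattice such that $E^\ast$ and $F$ both have order continuous norms, then every positive operator $T:E\to F$ is AM-compact. (iv) If $E^\ast$ is a KB-space and $Y$ is a Banach space which does not contain $c_0$, then every bounded operator $T:E\to Y$ is AM-compact.
   Context: All vector spaces are real and all operators are linear; operators below are bounded. A bounded subset $C$ of a Banach space $X$ is limited if every $\mathrm{w}^\ast$-null sequence in $X^\ast$ converges to zero uniformly on $C$. A bounded operator $T:E\to Y$ from a Banach lattice to a Banach space is AM-compact if $T[-x,x]$ is relatively compact for every $x\in E_+$, and order weakly compact if $T[0,x]$ is relatively weakly compact for every $x\in E_+$. A KB-space is a Banach lattice in which every norm bounded increasing sequence of positive elements is norm convergent. ''Contains $c_0$'' means contains a closed subspace isomorphic to $c_0$. *)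

(* Defs.v *)
From HB Require Import structures.
From mathcomp Require Import all_boot all_order all_algebra.
From mathcomp Require Import all_classical all_reals all_analysis.

Set Implicit Arguments.
Unset Strict Implicit.
Unset Printing Implicit Defensive.

Import Order.TTheory GRing.Theory Num.Theory.
Import numFieldNormedType.Exports.

Local Open Scope classical_set_scope.
Local Open Scope ring_scope.

(* An ordered normed space is not declared as a join of Order.POrder and
   NormedModule, because HB would then require Num.NumDomain to inherit from it.
   The order is a field of the mixin, and the library order structures are derived
   from it, so that <= and Order.join are vle and vjoin. The class is the common
   signature of Banach lattices and of their duals. *)
HB.mixin Record NormedModule_isOrdered (R : realType) V of NormedModule R V := {
  vle : rel V ;
  vle_refl : reflexive vle ;
  vle_anti : antisymmetric vle ;
  vle_trans : transitive vle ;
  vle_add2r : forall z x y : V, vle x y -> vle (x + z) (y + z) ;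
  vle_scale2l : forall (a : R) (x y : V),
    0 <= a -> vle x y -> vle (a *: x) (a *: y)
}.

#[short(type="orderedNormedModType")]
HB.structure Definition OrderedNormedModule (R : realType) :=
  {V of NormedModule_isOrdered R V & NormedModule R V}.

HB.instance Definition _ (R : realType) (V : orderedNormedModType R) :=
  Order.Le_isPOrder.Build ring_display (OrderedNormedModule.sort V)
    vle_refl vle_anti vle_trans.

HB.mixin Record isBanachLattice (R : realType) V
    of OrderedNormedModule R V & CompleteNormedModule R V := {
  vmeet : V -> V -> V ;
  vjoin : V -> V -> V ;
  vmeetP : forall x y z : V, vle x (vmeet y z) = vle x y && vle x z ;
  vjoinP : forall x y z : V, vle (vjoin x y) z = vle x z && vle y z ;
  vnorm_le : forall x y : V,
    vle (vjoin x (- x)) (vjoin y (- y)) -> `|x| <= `|y|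
}.

#[short(type="banachLatticeType")]
HB.structure Definition BanachLattice (R : realType) :=
  {V of isBanachLattice R V & OrderedNormedModule R V
      & CompleteNormedModule R V}.

HB.instance Definition _ (R : realType) (E : banachLatticeType R) :=
  Order.POrder.copy (BanachLattice.sort E)
    (OrderedNormedModule.sort (E : orderedNormedModType R)).

HB.instance Definition _ (R : realType) (E : banachLatticeType R) :=
  Order.POrder_MeetJoin_isLattice.Build ring_display (BanachLattice.sort E)
    vmeetP vjoinP.

Section dual.
Context {R : realType}.

Definition bounded_operator (V W : normedModType R) (T : V -> W) :=
  exists M : R, forall x, `|T x| <= M * `|x|.

Definition dual_pred (V : normedModType R) : {pred V -> R^o} :=
  fun f => `[< linear f /\ bounded_operator f >].

Lemma dual_submod_closed (V : normedModType R) : submod_closed (@dual_pred V).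
Proof.
split; rewrite /dual_pred /in_mem /=.
  apply/asboolP; split; first by move=> a u v; rewrite scaler0 addr0.
  by exists 0 => x; rewrite normr0 mul0r.
move=> a f g /asboolP[lf [M Mf]] /asboolP[lg [N Ng]]; apply/asboolP; split.
  move=> b u v; rewrite !fctE lf lg.
  by rewrite !scalerDr !scalerA addrACA (mulrC b).
exists (`|a| * M + N) => x; rewrite !fctE.
apply: (le_trans (ler_normD _ _)); rewrite normrZ mulrDl -mulrA.
by rewrite lerD // ler_wpM2l.
Qed.

End dual.

HB.instance Definition _ (R : realType) (V : normedModType R) :=
  GRing.isSubmodClosed.Build R (V -> R^o) (@dual_pred R V)
    (@dual_submod_closed R V).

Record dual (R : realType) (V : normedModType R) := Dual {
  dual_fun :> V -> R^o ;
  dual_funP : dual_fun \in @dual_pred R V }.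

HB.instance Definition _ (R : realType) (V : normedModType R) :=
  [isSub for @dual_fun R V].
HB.instance Definition _ (R : realType) (V : normedModType R) :=
  [Choice of dual V by <:].
HB.instance Definition _ (R : realType) (V : normedModType R) :=
  [SubChoice_isSubLmodule of dual V by <:].

Section dual_norm.
Context {R : realType} {V : normedModType R}.
Implicit Types f g : dual V.

Lemma dual_linear f : linear f.
Proof. by have /asboolP[] := dual_funP f. Qed.

Lemma dual_bounded f : bounded_operator f.
Proof. by have /asboolP[] := dual_funP f. Qed.

HB.instance Definition _ f :=
  GRing.isLinear.Build R V R^o *:%R (dual_fun f) (dual_linear f).

Definition dual_norm f : R := sup [set `|f x| | x in [set x : V | `|x| <= 1]].

Lemma dual_norm_has_sup f : has_sup [set `|f x| | x in [set x : V | `|x| <= 1]].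
Proof.
split; first by exists `|f 0|, 0 => //=; rewrite normr0 ler01.
have [M fM] := dual_bounded f; exists `|M| => _ [x /= x1 <-].
rewrite (le_trans (fM x)) // (le_trans (ler_wpM2r _ (ler_norm M))) //.
by rewrite ler_piMr.
Qed.

Lemma dual_norm_ub f x : `|x| <= 1 -> `|f x| <= dual_norm f.
Proof. by move=> x1; apply: (sup_upper_bound (dual_norm_has_sup f)); exists x. Qed.

Lemma dual_norm_le f (M : R) :
  (forall x : V, `|x| <= 1 -> `|f x| <= M) -> dual_norm f <= M.
Proof.
move=> fM; apply: ge_sup; first by case: (dual_norm_has_sup f).
by move=> _ [x x1 <-]; exact: fM.
Qed.

Lemma dual_normD f g : dual_norm (f + g) <= dual_norm f + dual_norm g.
Proof.
apply: dual_norm_le => x x1.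
by rewrite (le_trans (ler_normD (f x) (g x))) // lerD ?dual_norm_ub.
Qed.

Lemma dual_normZ (a : R) f : dual_norm (a *: f) = `|a| * dual_norm f.
Proof.
have le_normZ (b : R) h : dual_norm (b *: h) <= `|b| * dual_norm h.
  apply: dual_norm_le => x x1.
  have -> : (b *: h) x = b *: h x by [].
  by rewrite normrZ ler_wpM2l // dual_norm_ub.
apply/eqP; rewrite eq_le le_normZ /=.
have [->|a0] := eqVneq a 0.
  rewrite normr0 mul0r; apply: le_trans (dual_norm_ub _ (_ : `|0| <= 1)) => //.
  by rewrite normr0 ler01.
rewrite -ler_pdivlMl ?normr_gt0 // -normfV.
by have := le_normZ a^-1 (a *: f); rewrite scalerA mulVf // scale1r.
Qed.

Lemma dual_norm0_eq0 f : dual_norm f = 0 -> f = 0.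
Proof.
move=> f0; apply/val_inj/funext => x /=.
have [->|x0] := eqVneq x 0; first by rewrite raddf0.
have : `|f (`|x|^-1 *: x)| <= 0.
  rewrite -f0 dual_norm_ub // normrZ normfV normr_id mulVf //.
  by rewrite normr_eq0.
rewrite linearZ /= normrZ pmulr_rle0 ?normr_gt0 ?invr_eq0 ?normr_eq0 //.
by rewrite normr_le0 => /eqP.
Qed.

HB.instance Definition _ := Lmodule_isNormed.Build R (dual V)
  dual_normD dual_normZ dual_norm0_eq0.

End dual_norm.

Section dual_order.
Context {R : realType} {E : banachLatticeType R}.
Implicit Types f g h : dual E.

Definition dual_le f g := `[< forall x : E, 0 <= x -> (f x : R) <= g x >].

Lemma dual_le_refl : reflexive dual_le.
Proof. by move=> f; apply/asboolP. Qed.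

Lemma dual_le_trans : transitive dual_le.
Proof.
move=> g f h /asboolP fg /asboolP gh; apply/asboolP => x x0.
exact: le_trans (fg _ x0) (gh _ x0).
Qed.

Lemma dual_le_anti : antisymmetric dual_le.
Proof.
move=> f g /andP[/asboolP fg /asboolP gf]; apply/val_inj/funext => /= x.
have fgE y : 0 <= y -> f y = g y.
  by move=> y0; apply/eqP; rewrite eq_le fg ?gf.
have := leUr (0 : E) x; have := vle_add2r (- x) _ _ (leUl x (0 : E)).
rewrite subrr; set u := Order.join _ _ => ux0 u0.
have fgx : f (u - x) = g (u - x) by apply: fgE.
by move: fgx; rewrite !linearB /= (fgE u u0) => /addrI/oppr_inj.
Qed.

Lemma dual_le_add2r h f g : dual_le f g -> dual_le (f + h) (g + h).
Proof.
by move=> /asboolP fg; apply/asboolP => x x0; rewrite [leLHS]/= lerD2r fg.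
Qed.

Lemma dual_le_scale2l (a : R) f g :
  0 <= a -> dual_le f g -> dual_le (a *: f) (a *: g).
Proof.
move=> a0 /asboolP fg; apply/asboolP => x x0.
by rewrite [leLHS]/= ler_wpM2l ?fg.
Qed.

HB.instance Definition _ := NormedModule_isOrdered.Build R (dual E)
  dual_le_refl dual_le_anti dual_le_trans dual_le_add2r dual_le_scale2l.

End dual_order.

Section c0.
Context (R : realType).

Definition c0_pred : {pred nat -> R^o} :=
  fun u => `[< (fun n => u n : R) @ \oo --> (0 : R) >].

Lemma c0_submod_closed : submod_closed c0_pred.
Proof.
split; rewrite /c0_pred /in_mem /=; first by apply/asboolP; exact: cvg_cst.
move=> a u v /asboolP u0 /asboolP v0; apply/asboolP.
have -> : (0 : R) = a *: (0 : R^o) + 0 by rewrite scaler0 addr0.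
by apply: cvgD => //; apply: (@cvgZr _ R^o).
Qed.

HB.instance Definition _ :=
  GRing.isSubmodClosed.Build R (nat -> R^o) c0_pred c0_submod_closed.

Record c0 := C0 { c0_seq :> nat -> R^o ; c0_seqP : c0_seq \in c0_pred }.

HB.instance Definition _ := [isSub for c0_seq].
HB.instance Definition _ := [Choice of c0 by <:].
HB.instance Definition _ := [SubChoice_isSubLmodule of c0 by <:].

Implicit Types u v : c0.

Definition c0_norm u : R := sup [set `|u n| | n in [set: nat]].

Lemma c0_norm_has_sup u : has_sup [set `|u n| | n in [set: nat]].
Proof.
split; first by exists `|u 0%N|, 0%N.
have /asboolP u0 := c0_seqP u.
have [M [_ uM]] : bounded_fun (fun n => u n : R).
  by apply: cvg_seq_bounded; apply/cvg_ex; exists 0.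
by exists (M + 1) => _ [n _ <-]; apply: (uM (M + 1)) => //; rewrite ltrDl.
Qed.

Lemma c0_norm_ub u n : `|u n| <= c0_norm u.
Proof. by apply: (sup_upper_bound (c0_norm_has_sup u)); exists n. Qed.

Lemma c0_norm_le u (M : R) : (forall n, `|u n| <= M) -> c0_norm u <= M.
Proof.
move=> uM; apply: ge_sup; first by case: (c0_norm_has_sup u).
by move=> _ [n _ <-]; exact: uM.
Qed.

Lemma c0_normD u v : c0_norm (u + v) <= c0_norm u + c0_norm v.
Proof.
apply: c0_norm_le => n.
by rewrite (le_trans (ler_normD (u n) (v n))) // lerD ?c0_norm_ub.
Qed.

Lemma c0_normZ (a : R) u : c0_norm (a *: u) = `|a| * c0_norm u.
Proof.
have le_normZ (b : R) w : c0_norm (b *: w) <= `|b| * c0_norm w.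
  apply: c0_norm_le => n.
  have -> : (b *: w) n = b *: w n by [].
  by rewrite normrZ ler_wpM2l // c0_norm_ub.
apply/eqP; rewrite eq_le le_normZ /=.
have [->|a0] := eqVneq a 0.
  by rewrite normr0 mul0r (le_trans _ (c0_norm_ub _ 0%N)).
rewrite -ler_pdivlMl ?normr_gt0 // -normfV.
by have := le_normZ a^-1 (a *: u); rewrite scalerA mulVf // scale1r.
Qed.

Lemma c0_norm0_eq0 u : c0_norm u = 0 -> u = 0.
Proof.
move=> u0; apply/val_inj/funext => n /=; apply/eqP.
by rewrite -normr_le0 -u0 c0_norm_ub.
Qed.

HB.instance Definition _ := Lmodule_isNormed.Build R c0
  c0_normD c0_normZ c0_norm0_eq0.

End c0.

Definition weak {R : realType} (Y : normedModType R) : topologicalType :=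
  sup_topology (fun f : dual Y => Topological.class (initial_topology f)).

Section definitions.
Context {R : realType}.

Definition contains_c0 (Y : normedModType R) :=
  exists J : {linear c0 R -> Y},
    [/\ closed (range J), bounded_operator J
      & exists2 m : R, 0 < m & forall u, m * `|u| <= `|J u|].

Definition weak_star_null (X : normedModType R) (f : nat -> dual X) :=
  {ptws, (fun n => f n : X -> R) @ \oo --> (cst 0 : X -> R)}.

Definition limited (X : completeNormedModType R) (C : set X) :=
  bounded_set C /\
  forall f : nat -> dual X, weak_star_null f ->
    {uniform C, (fun n => f n : X -> R) @ \oo --> (cst 0 : X -> R)}.

Definition relatively_weakly_compact (Y : normedModType R) (A : set Y) :=
  precompact (A : set (weak Y)).

Definition weakly_compact_operator (X Y : normedModType R) (T : X -> Y) :=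
  relatively_weakly_compact (T @` [set x | `|x| <= 1]).

Definition AM_compact (E : banachLatticeType R) (Y : completeNormedModType R)
    (T : E -> Y) :=
  forall x : E, 0 <= x -> precompact (T @` `[- x, x]).

Definition order_weakly_compact (E : banachLatticeType R)
    (Y : completeNormedModType R) (T : E -> Y) :=
  forall x : E, 0 <= x -> relatively_weakly_compact (T @` `[0, x]).

Definition positive_operator (E F : banachLatticeType R) (T : E -> F) :=
  forall x : E, 0 <= x -> 0 <= T x.

(* A net decreasing to 0 is given by its range, a downward directed set with
   infimum 0. *)
Definition order_continuous_norm (V : orderedNormedModType R) :=
  forall D : set V, D !=set0 ->
    (forall x y, D x -> D y -> exists2 z, D z & z <= x /\ z <= y) ->
    infimums D 0 -> inf [set `|x| | x in D] = 0.

Definition KB_space (V : orderedNormedModType R) :=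
  forall u : nat -> V, (forall n, 0 <= u n) -> nondecreasing_seq u ->
    bounded_fun u -> cvgn u.

End definitions.

(* Main.v *)
(* Call [T] null on summable sequences if [T d_n] tends to [0] in norm whenever
   the [d_n] are positive and their partial sums are order bounded. In each of
   the four cases [T] has this property. If [|T d_n|] stayed away from [0],
   Rosenthal's lemma would give a subsequence equivalent to the unit vector basis
   of [c0], against weak compactness of the images of the order intervals or
   against the absence of [c0] in [Y]; in case (iii) the partial sums of the
   [T d_n] are Cauchy.

   Limited order intervals make [-x, x] totally bounded for every seminorm
   [h(|.|)] with [h] a positive functional. Otherwise one finds by Hahn-Banach
   functionals [f_n] with [|f_n| <= h] and [v_n] in [-2x, 2x] such that
   [f_n(v_n) >= e] while [f_i(v_n)] is small for [i < n]. On functionals dominated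
   by [h] an ultrafilter limit of [sum_z f(z) g(z) / h(z)] over partitions of [2x] is a
   semi-inner product which controls the pointwise values on [0, 2x], so by
   Bessel's inequality some almost orthogonal differences of the [f_n] are weak*
   null, but they are not uniformly small on [-2x, 2x].

   Finally, if [T] mapped an order interval to a set which is not totally bounded,
   the total boundedness for the moduli [|f o T|] would produce inductively
   order bounded [u_k >= 0] and [h_k = |f_k o T|] with [h_k(u_k) >= e] and
   [h_k(u_j)] tiny for [k < j]; disjointifying the [u_k] contradicts nullity on
   summable sequences. *)

Require Import Defs.
From HB Require Import structures.
From mathcomp Require Import all_boot all_order all_algebra.
From mathcomp Require Import all_classical all_reals all_analysis.
From mathcomp Require Import ring lra.

Set Implicit Arguments.
Unset Strict Implicit.
Unset Printing Implicit Defensive.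

Import Order.TTheory GRing.Theory Num.Theory.
Import numFieldNormedType.Exports.

Local Open Scope classical_set_scope.
Local Open Scope ring_scope.

(** * Sequences chosen one term at a time *)

(** Dependent choice where a new term may depend on all earlier ones. The history is a finite list,
    so one choice function on lists suffices; [t0] is a default value. *)
Lemma greedy_sequence (T : Type) (t0 : T) (Q : T -> Prop)
    (S : nat -> T -> T -> Prop) :
  (forall n (u : nat -> T), (forall i, (i < n)%N -> Q (u i)) ->
     exists a, Q a /\ forall i, (i < n)%N -> S n (u i) a) ->
  exists u : nat -> T,
    (forall n, Q (u n)) /\ forall i n, (i < n)%N -> S n (u i) (u n).
Proof.
move=> step.
pose good n (u : nat -> T) a := Q a /\ forall i, (i < n)%N -> S n (u i) a.
have /choice[g gP] (s : seq T) : exists a,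
    (forall i, (i < size s)%N -> Q (nth t0 s i)) -> good (size s) (nth t0 s) a.
  have [sQ|] := pselect (forall i, (i < size s)%N -> Q (nth t0 s i)).
    by have [a ?] := step _ _ sQ; exists a.
  by exists t0.
pose F := fix F n := if n is n'.+1 then rcons (F n') (g (F n')) else [::].
have sF n : size (F n) = n by elim: n => //= n IH; rewrite size_rcons IH.
have nF m n : (n < m)%N -> nth t0 (F m) n = g (F n).
  elim: m => // m IH; rewrite ltnS leq_eqVlt => /predU1P[->|nm] /=.
    by rewrite nth_rcons sF ltnn eqxx.
  by rewrite nth_rcons sF nm IH.
have gF n : good n (nth t0 (F n)) (g (F n)).
  elim/ltn_ind: n => n IH; have := gP (F n); rewrite sF; apply => i ni.
  by rewrite nF //; have [] := IH _ ni.
exists (fun n => g (F n)); split => [n|i n ni]; first by have [] := gF n.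
by have [_ /(_ _ ni)] := gF n; rewrite nF.
Qed.

(** * The Hahn-Banach theorem *)

Section hahn_banach.
Context {R : realType} {V : lmodType R}.

Definition sublinear (p : V -> R) :=
  [/\ 0 <= p 0, forall x y, p (x + y) <= p x + p y
    & forall (t : R) x, 0 < t -> p (t *: x) <= t * p x].

Lemma sublinear0 p : sublinear p -> p 0 = 0.
Proof.
move=> [p0 _ /(_ 2^-1 0)]; rewrite scaler0 invr_gt0 ltr0n => /(_ isT).
by move: p0; lra.
Qed.

Lemma sublinear_geN p x : sublinear p -> - p (- x) <= p x.
Proof. by move=> [p0 /(_ x (- x)) pD _]; rewrite subrr in pD; lra. Qed.

(** The minorant [l] keeps the infima finite. The lemma serves for translates, for chains and for
    the distance to a span. *)
Lemma sublinear_inf (I : Type) (D : set I) (q : I -> V -> R) (l : V -> R) :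
  D !=set0 -> (forall i x, D i -> l x <= q i x) ->
  (forall i, D i -> 0 <= q i 0) ->
  (forall i j x y, D i -> D j ->
     exists2 k, D k & q k (x + y) <= q i x + q j y) ->
  (forall i (t : R) x, D i -> 0 < t ->
     exists2 k, D k & q k (t *: x) <= t * q i x) ->
  exists r, [/\ sublinear r, forall i x, D i -> r x <= q i x
    & forall m x, (forall i, D i -> m <= q i x) -> m <= r x].
Proof.
move=> [i0 Di0] lq q0 qD qZ; pose r x := inf [set q i x | i in D].
have ler i x : D i -> r x <= q i x.
  move=> Di; apply: ge_inf; last by exists i.
  by exists (l x) => _ [j Dj <-]; exact: lq.
have ger m x : (forall i, D i -> m <= q i x) -> m <= r x.
  by move=> mq; apply: lb_le_inf; [exists (q i0 x), i0|move=> _ [i Di <-]; exact: mq].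
exists r; split => //; split; first exact: ger.
  move=> x y; rewrite -lerBlDr; apply: (ger) => i Di; rewrite lerBlDr -lerBlDl.
  apply: (ger) => j Dj; rewrite lerBlDl.
  by have [k Dk /(le_trans _)] := qD i j x y Di Dj; apply; exact: ler.
move=> t x t0; rewrite -ler_pdivrMl //; apply: (ger) => i Di; rewrite ler_pdivrMl //.
by have [k Dk /(le_trans _)] := qZ i t x Di t0; apply; exact: ler.
Qed.

(** [q x] is the infimum of [p (x + t *: y) - t * p y] over [t >= 0]: [t = 0] gives [q <= p], and
    [t = 1] gives the bound at [- y]. *)
Lemma sublinear_translate p y : sublinear p ->
  exists q, [/\ sublinear q, forall x, q x <= p x & q (- y) <= - p y].
Proof.
move=> sp; have [p0 pD pZ] := sp.
have tp t : 0 <= t -> t * p y <= p (t *: y).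
  rewrite le_eqVlt => /predU1P[<-|t0]; first by rewrite scale0r mul0r.
  have := pZ t^-1 (t *: y); rewrite invr_gt0 => /(_ t0).
  by rewrite scalerA mulVf ?gt_eqF // scale1r ler_pdivlMl.
have [|||||q [sq qle _]] := @sublinear_inf R [set t | 0 <= t]
  (fun t x => p (x + t *: y) - t * p y) (fun x => - p (- x)).
- by exists 0 => /=.
- by move=> t x /= /tp; have := pD (- x) (x + t *: y); rewrite addKr; lra.
- by move=> t /= /tp; rewrite add0r subr_ge0.
- move=> s t u v /= s0 t0; exists (s + t); first exact: addr_ge0.
  have := pD (u + s *: y) (v + t *: y).
  by rewrite addrACA -scalerDl; lra.
- move=> t s x /= t0 s0; exists (s * t); first by rewrite mulr_ge0 // ltW.
  have := pZ s (x + t *: y) s0; rewrite scalerDr scalerA; lra.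
exists q; split => // [x|].
  by have := qle 0 x (lexx 0); rewrite scale0r mul0r addr0 subr0.
have /le_trans -> // := qle 1 (- y) ler01.
by rewrite scale1r addNr mul1r (sublinear0 sp) sub0r.
Qed.

Lemma sublinear_chain_lb p (A : set (V -> R)) :
  A !=set0 -> (forall q, A q -> sublinear q /\ forall x, q x <= p x) ->
  (forall q r, A q -> A r -> (forall x, q x <= r x) \/ (forall x, r x <= q x)) ->
  exists r, sublinear r /\ forall q x, A q -> r x <= q x.
Proof.
move=> A0 Ap tA.
have [|||||r [sr rle _]] := @sublinear_inf (V -> R) A
  (fun q => q) (fun x => - p (- x)).
- by [].
- move=> q x /Ap[sq qp]; apply: le_trans (sublinear_geN x sq).
  by rewrite lerN2.
- by move=> q /Ap[[]].
- move=> q r x y Aq Ar; have [[_ qD _] _] := Ap _ Aq; have [[_ rD _] _] := Ap _ Ar.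
  have [qr|rq] := tA _ _ Aq Ar.
    by exists q => //; have := qr y; have := qD x y; lra.
  by exists r => //; have := rq x; have := rD x y; lra.
- by move=> q t x Aq t0; exists q => //; have [[_ _ ->]] := Ap _ Aq.
by exists r.
Qed.

(* Replacing a minimal [q] by [x |-> inf_(t >= 0) q (x + t y) - t q y] cannot
   decrease it. *)
Lemma minimal_sublinear_linear (q : V -> R) : sublinear q ->
  (forall r, sublinear r -> (forall x, r x <= q x) -> forall x, q x <= r x) ->
  linear (q : V -> R^o).
Proof.
move=> sq minq; have [q0 qD qZ] := sq.
have qN y : q (- y) = - q y.
  apply/eqP; rewrite eq_le; apply/andP; split.
    have [r [sr rq ry]] := sublinear_translate y sq.
    exact: le_trans (minq r sr rq _) ry.
  by rewrite lerNl -[in leRHS](opprK y) lerNl sublinear_geN.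
move=> t x y; have qDE u v : q (u + v) = q u + q v.
  apply/eqP; rewrite eq_le qD /=.
  by have := qD (- u) (- v); rewrite -opprD !qN; lra.
have qZE s u : 0 < s -> q (s *: u) = s * q u.
  move=> s0; apply/eqP; rewrite eq_le qZ //=.
  by have := qZ s (- u) s0; rewrite scalerN !qN; lra.
rewrite qDE; congr (_ + _); have [t0|t0|->] := ltrgtP t 0.
- by have := qZE (- t) x; rewrite scaleNr qN oppr_gt0 => /(_ t0); rewrite mulNr => /oppr_inj.
- exact: qZE.
by rewrite !scale0r -[in LHS](subrr 0) qDE qN subrr.
Qed.

(** Zorn's lemma for the reversed pointwise order gives a minimal sublinear functional below the
    translate [p']. It is linear, and [p' (- z) <= - p z] forces its value at [z]. *)
Theorem hahn_banach (p : V -> R) (z : V) : sublinear p ->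
  exists f : V -> R, [/\ linear (f : V -> R^o), forall x, f x <= p x & f z = p z].
Proof.
move=> sp; have [p' [sp' p'p p'z]] := sublinear_translate z sp.
pose S := {q : V -> R | sublinear q /\ forall x, q x <= p' x}.
pose le (q r : S) := `[< forall x, sval r x <= sval q x >].
have [q qmin] : exists q, forall r, le q r -> r = q.
  apply: Zorn.
  - by move=> q; apply/asboolP.
  - move=> q r s /asboolP qr /asboolP rs; apply/asboolP => x.
    exact: le_trans (rs x) (qr x).
  - move=> [q Hq] [r Hr] /asboolP /= qr /asboolP /= rq; apply: eq_exist => /=.
    by apply/funext => x; apply/eqP; rewrite eq_le qr rq.
  - move=> A tA; have [[q0 Aq0]|A0] := pselect (A !=set0); last first.
      by exists (exist _ p' (conj sp' (fun=> lexx _))) => s As; case: A0; exists s.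
    have [|||r [sr rle]] := @sublinear_chain_lb p' [set sval q | q in A].
    + by exists (sval q0), q0.
    + by move=> _ [q _ <-]; exact: (svalP q).
    + move=> _ _ [q Aq <-] [r Ar <-].
      by have [/asboolP|/asboolP] := tA _ _ Aq Ar; [right|left].
    have rp x : r x <= p' x.
      apply: le_trans (rle (sval q0) x _) ((svalP q0).2 x).
      by exists q0.
    exists (exist _ r (conj sr rp)) => s As; apply/asboolP => x /=.
    by apply: rle; exists s.
have [sq qp'] := svalP q.
have lq : linear (sval q : V -> R^o).
  apply: minimal_sublinear_linear => // r sr rq.
  have rp' x : r x <= p' x by exact: le_trans (rq x) (qp' x).
  have /(congr1 sval) /= rE := qmin (exist _ r (conj sr rp')) (asboolT rq).
  by move=> x; rewrite -rE.
exists (sval q); split => // [x|]; first exact: le_trans (qp' x) (p'p x).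
apply/eqP; rewrite eq_le (le_trans (qp' z) (p'p z)) /=.
have := le_trans (qp' (- z)) p'z.
have := lq (-1) z 0; rewrite addr0 scaleN1r => ->.
have := lq (-1) 0 0; rewrite scaler0 addr0 scaleN1r addNr => ->.
by rewrite addr0 [X in X <= _](_ : _ = - (sval q z)) ?scaleN1r // lerN2.
Qed.

End hahn_banach.

(** * Ultrafilters and compactness *)

Section filters.
Context {R : realType}.

Lemma ultra_bounded_cvg (T : Type) (U : set_system T) (a : T -> R) (M : R) :
  UltraFilter U -> (forall t, `|a t| <= M) ->
  exists l : R, forall e : R, 0 < e -> U [set t | `|a t - l| < e].
Proof.
move=> UU aM; have [|l [_ cl]] := @segment_compact R (- M) M (a @ U) _.
  apply: (@filterE _ U) => t /=.
  by rewrite in_itv /= -ler_norml aM.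
exists l => e e0; have [//|Uc] := in_ultra_setVsetC [set t | `|a t - l| < e] UU.
have [] := cl [set r | ~ `|r - l| < e] (ball l e).
- exact: Uc.
- exact: nbhsx_ballx.
- by move=> r [] /= + ; rewrite -ball_normE /= distrC.
Qed.

Lemma ultra_seq_cover (T : Type) (I : Type) (U : set_system T) (s : seq I)
    (B : I -> set T) :
  UltraFilter U -> U [set t | exists i, List.In i s /\ B i t] ->
  exists i, U (B i).
Proof.
move=> UU; elim: s => [|i s IH] Us.
  have /filter_ex[t [i []]] := Us; by [].
have [|Uc] := in_ultra_setVsetC (B i) UU; first by exists i.
apply: IH; apply: filterS2 Us Uc => t [j [[<-|js]] Bj] nB //.
by exists j.
Qed.

(** Without a finite [e]-net, greedy choice would give an [e]-separated sequence. Finite nets make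
    every ultrafilter on the closure Cauchy, hence convergent. *)
Lemma separated_precompact (Y : completeNormedModType R) (A : set Y) :
  (forall (e : R) (y : nat -> Y), 0 < e -> (forall n, A (y n)) ->
     exists m n, (m < n)%N /\ `|y m - y n| < e) ->
  precompact A.
Proof.
move=> Asep; rewrite precompactE compact_ultra => F UF FA.
have cover (e : R) : 0 < e -> exists s : seq Y,
    forall y, A y -> exists z, List.In z s /\ `|z - y| < e.
  move=> e0; apply: contrapT => /forallNP nos.
  have [|u [uA uS]] := @greedy_sequence Y 0 A (fun _ y z => e <= `|y - z|).
    move=> n u _; have /existsNP[y /not_implyP[Ay /forallNP yu]] := nos (mkseq u n).
    exists y; split => // i ni; rewrite leNgt; apply/negP => ie.
    apply: (yu (u i)); split => //; rewrite /mkseq; apply: List.in_map.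
    have : i \in iota 0 n by rewrite mem_iota.
    elim: (iota 0 n) => //= j l IH; rewrite inE => /predU1P[->|/IH]; by [left|right].
  have [m [n [mn]]] := Asep e u e0 uA.
  by rewrite ltNge uS.
have cF : cauchy F.
  apply: cauchy_exP => e e0; have e20 : 0 < e / 2 by rewrite divr_gt0.
  have [s sA] := cover _ e20.
  apply: (@ultra_seq_cover _ _ F s (fun z => ball z e)) => //.
  apply: filterS FA => y clAy.
  have [z [Az yz]] := clAy (ball y (e / 2)) (nbhsx_ballx _ _ e20).
  have [w [sw wz]] := sA _ Az; exists w; split => //.
  rewrite -ball_normE /=; move: yz; rewrite -ball_normE /= => yz.
  rewrite (splitr e) (le_lt_trans (ler_distD z _ _)) // ltrD //.
  by rewrite distrC.
have [p Fp] := (cvg_ex _).1 (@cauchy_cvg Y F _ cF).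
exists p; split => //.
by apply: (@closed_cvg _ _ F _ id _ (@closed_closure _ A) FA).
Qed.

End filters.

(** * Banach lattices *)

Section banach_lattice.
Context {R : realType} {E : banachLatticeType R}.
Implicit Types u v w x y z : E.

Definition vpos x : E := Order.join x 0.
Definition vabs x : E := Order.join x (- x).

Lemma levD2r z x y : (x + z <= y + z) = (x <= y).
Proof.
apply/idP/idP => [|/(vle_add2r z _ _)//].
by move=> /(vle_add2r (- z) _ _); rewrite !addrK.
Qed.

Lemma levD2l z x y : (z + x <= z + y) = (x <= y).
Proof. by rewrite ![z + _]addrC levD2r. Qed.

Lemma subv_ge0 x y : (0 <= y - x) = (x <= y).
Proof. by rewrite -(levD2r x 0) add0r subrK. Qed.

Lemma levBl x y z : (x - y <= z) = (x <= z + y).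
Proof. by rewrite -(levD2r y (x - y)) subrK. Qed.

Lemma levBr x y z : (x <= y - z) = (x + z <= y).
Proof. by rewrite -(levD2r z x) subrK. Qed.

Lemma levD x y z w : x <= y -> z <= w -> x + z <= y + w.
Proof. by move=> xy zw; rewrite (@le_trans _ _ (y + z)) ?levD2r ?levD2l. Qed.

Lemma addv_ge0 x y : 0 <= x -> 0 <= y -> 0 <= x + y.
Proof. by move=> x0 y0; rewrite -[0]addr0 levD. Qed.

Lemma levN x y : (- x <= - y) = (y <= x).
Proof. by rewrite -(subv_ge0 (- x)) opprK addrC subv_ge0. Qed.

Lemma oppv_le0 x : (- x <= 0) = (0 <= x).
Proof. by rewrite -[in LHS]oppr0 levN. Qed.

Lemma oppv_le x : 0 <= x -> - x <= x.
Proof. by move=> x0; rewrite (@le_trans _ _ 0) ?oppv_le0. Qed.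

Lemma subv_le x y : 0 <= y -> x - y <= x.
Proof. by move=> y0; rewrite levBl -[leLHS]addr0 levD2l. Qed.

Lemma addv_le x y : 0 <= y -> x <= x + y.
Proof. by move=> y0; rewrite -[leLHS]addr0 levD2l. Qed.

Lemma scalev_le (a : R) x y : 0 <= a -> x <= y -> a *: x <= a *: y.
Proof. by move=> a0 xy; exact: vle_scale2l. Qed.

Lemma scalev_ge0 (a : R) x : 0 <= a -> 0 <= x -> 0 <= a *: x.
Proof. by move=> a0 /(scalev_le a0); rewrite scaler0. Qed.

Lemma scalev_lel (a b : R) x : 0 <= x -> a <= b -> a *: x <= b *: x.
Proof. by move=> x0 ab; rewrite -subv_ge0 -scalerBl scalev_ge0 ?subr_ge0. Qed.

Lemma sumv_ge0 (I : Type) (s : seq I) (F : I -> E) :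
  (forall i, 0 <= F i) -> 0 <= \sum_(i <- s) F i.
Proof. by move=> F0; elim/big_rec: _ => // i x _; exact: addv_ge0. Qed.

Lemma lev_sum (I : Type) (s : seq I) (F G : I -> E) :
  (forall i, F i <= G i) -> \sum_(i <- s) F i <= \sum_(i <- s) G i.
Proof. by move=> FG; elim/big_rec2: _ => // i x y _; exact: levD. Qed.

Lemma vpos_ge0 x : 0 <= vpos x.
Proof. exact: leUr. Qed.

Lemma vpos_le x y : (vpos x <= y) = (x <= y) && (0 <= y).
Proof. by rewrite leUx. Qed.

Lemma le_vpos x : x <= vpos x.
Proof. exact: leUl. Qed.

Lemma vposBN x : vpos x - vpos (- x) = x.
Proof.
apply/eqP; rewrite eq_le; apply/andP; split.
  rewrite levBl vpos_le addv_le ?vpos_ge0 //= -[leLHS](addrN x) levD2l.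
  exact: le_vpos.
rewrite levBr addrC -levBr vpos_le levBr addNr vpos_ge0 /=.
by rewrite subv_ge0 le_vpos.
Qed.

Lemma vabs_le x y : (vabs x <= y) = (- y <= x <= y).
Proof. by rewrite leUx andbC -[- x <= y]levN opprK. Qed.

Lemma vabsP x : - vabs x <= x <= vabs x.
Proof. by rewrite -vabs_le. Qed.

Lemma vabs_ge0 x : 0 <= vabs x.
Proof.
have h : 0 <= vabs x + vabs x by rewrite -(subrr x) levD ?leUl ?leUr.
have := @scalev_ge0 2^-1 _ _ h; rewrite invr_ge0 ler0n => /(_ isT).
rewrite -(mulr2n (vabs x)) -(scaler_nat 2 (vabs x)).
by rewrite scalerA mulVf ?scale1r // pnatr_eq0.
Qed.

Lemma ge0_vabs x : 0 <= x -> vabs x = x.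
Proof.
move=> x0; apply/eqP; rewrite eq_le vabs_le lexx leUl !andbT.
exact: oppv_le.
Qed.

Lemma vabsN x : vabs (- x) = vabs x.
Proof. by rewrite /vabs opprK joinC. Qed.

Lemma vabsD x y : vabs (x + y) <= vabs x + vabs y.
Proof.
have /andP[x1 x2] := vabsP x; have /andP[y1 y2] := vabsP y.
by rewrite vabs_le opprD !levD.
Qed.

Lemma vabsZ (a : R) x : 0 <= a -> vabs (a *: x) <= a *: vabs x.
Proof.
by move=> a0; have /andP[x1 x2] := vabsP x; rewrite vabs_le -scalerN !scalev_le.
Qed.

Lemma vpos_le_vabs x : vpos x <= vabs x.
Proof. by rewrite vpos_le vabs_ge0 andbT leUl. Qed.

Lemma vabs_vpos_bound x y : vabs x <= y -> vpos x <= y /\ vpos (- x) <= y.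
Proof.
by move=> xy; split; apply: le_trans (vpos_le_vabs _) _; rewrite ?vabsN.
Qed.

Lemma normv_vabs_le x y : vabs x <= vabs y -> `|x| <= `|y|.
Proof. exact: vnorm_le. Qed.

Lemma normv_le x y : 0 <= y -> vabs x <= y -> `|x| <= `|y|.
Proof. by move=> y0 xy; apply: normv_vabs_le; rewrite (ge0_vabs y0). Qed.

Lemma normv_vabs x : `|vabs x| = `|x|.
Proof.
apply/eqP; rewrite eq_le; apply/andP; split; apply: normv_vabs_le.
  by rewrite ge0_vabs ?vabs_ge0.
by rewrite [leRHS]ge0_vabs ?vabs_ge0.
Qed.

Lemma normv_ge0_le x y : 0 <= x -> x <= y -> `|x| <= `|y|.
Proof. by move=> x0 xy; apply: normv_le; rewrite ?ge0_vabs // (le_trans x0). Qed.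

Lemma normv_vpos x : `|vpos x| <= `|x|.
Proof. by rewrite -[leRHS]normv_vabs normv_ge0_le ?vpos_ge0 ?vpos_le_vabs. Qed.

(** The first summand is the truncation of [z] to [[-u, u]]; the remainder lies in [[-v, v]] because
    [vabs z <= u + v]. *)
Lemma riesz_decomposition u v z : 0 <= u -> 0 <= v -> vabs z <= u + v ->
  exists a b, [/\ z = a + b, vabs a <= u & vabs b <= v].
Proof.
move=> u0 v0; rewrite vabs_le => /andP[z1 z2].
exists (Order.join (Order.meet z u) (- u)),
  (z - Order.join (Order.meet z u) (- u)).
split; first by rewrite addrC subrK.
  by rewrite vabs_le leUr leUx leIr oppv_le.
rewrite vabs_le; apply/andP; split.
  rewrite levBr addrC levBl leUx (le_trans (leIl _ _)) ?addv_le //=.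
  by rewrite -levBl -opprD.
by rewrite levBl addrC -levBl; apply: le_trans (leUl _ _);
  rewrite lexI subv_le //= levBl.
Qed.

Lemma riesz_decomposition_ge0 u v y : 0 <= u -> 0 <= v -> 0 <= y -> y <= u + v ->
  exists a b, [/\ y = a + b, 0 <= a, a <= u, 0 <= b & b <= v].
Proof.
move=> u0 v0 y0 yuv; exists (Order.meet y u), (y - Order.meet y u); split.
- by rewrite addrC subrK.
- by rewrite lexI y0 u0.
- exact: leIr.
- by rewrite subv_ge0 leIl.
- by rewrite levBl addrC -levBl lexI subv_le //= levBl.
Qed.

(** Dividing by [n.+1] gives [vpos w <= n.+1%:R^-1 *: vpos c], so monotonicity of the norm forces
    [vpos w = 0]. *)
Lemma archimedean_le0 w c : (forall k : nat, k%:R *: w <= c) -> w <= 0.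
Proof.
move=> kw; have wn n : `|vpos w| <= n.+1%:R^-1 * `|c|.
  have n0 : (0 : R) < n.+1%:R by rewrite ltr0n.
  apply: (@le_trans _ _ `|n.+1%:R^-1 *: vpos c|); last first.
    by rewrite normrZ gtr0_norm ?invr_gt0 // ler_wpM2l ?invr_ge0 ?ler0n ?normv_vpos.
  apply: normv_ge0_le (vpos_ge0 _) _; rewrite vpos_le scalev_ge0 ?invr_ge0 ?vpos_ge0 //.
  have -> : w = n.+1%:R^-1 *: (n.+1%:R *: w).
    by rewrite scalerA mulVf ?scale1r // gt_eqF.
  by rewrite andbT scalev_le ?invr_ge0 // (le_trans (kw _)) // le_vpos.
have w0 : `|vpos w| = 0.
  apply/eqP; rewrite -normr_le0 normr_id leNgt; apply/negP => w0.
  have := truncnS_gt (`|c| / `|vpos w|); rewrite ltr_pdivrMr //.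
  by have := wn (Num.truncn (`|c| / `|vpos w|)); rewrite ler_pdivlMl ?ltr0n // leNgt => /negP.
by have /eqP := w0; rewrite normr_eq0 => /eqP <-; exact: le_vpos.
Qed.

End banach_lattice.

(** * Gram forms along partitions of a positive element *)

Section partitions.
Context {R : realType} {E : banachLatticeType R}.
Implicit Types (s : seq E) (x y z : E).

(** A bounded positive functional recorded on the positive cone alone, so that a modulus given by a
    supremum qualifies without being extended to [E]. *)
Definition cone_functional (h : E -> R) :=
  [/\ forall u v : E, 0 <= u -> 0 <= v -> h (u + v) = h u + h v,
      forall u : E, 0 <= u -> 0 <= h u,
      forall (t : R) (u : E), 0 <= t -> 0 <= u -> h (t *: u) = t * h u
    & exists M, forall u : E, 0 <= u -> h u <= M * `|u|].

Lemma cone_functional0 h : cone_functional h -> h 0 = 0.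
Proof. by case=> _ _ /(_ 0 0 (lexx _) (lexx _)) + _; rewrite scale0r mul0r. Qed.

Lemma cone_functional_le h u v : cone_functional h -> 0 <= u -> u <= v -> h u <= h v.
Proof.
move=> [hD h0 _ _] u0 uv; rewrite -[v](subrK u) addrC.
by rewrite hD ?subv_ge0 // lerDl h0 ?subv_ge0.
Qed.

Lemma cone_functional_sum h (I : eqType) (s : seq I) (F : I -> E) :
  cone_functional h -> (forall i, i \in s -> 0 <= F i) ->
  h (\sum_(i <- s) F i) = \sum_(i <- s) h (F i).
Proof.
move=> hh; have [hD _ _ _] := hh; elim: s => [|i s IH] F0.
  by rewrite !big_nil cone_functional0.
have Fs j : j \in s -> 0 <= F j by move=> js; apply: F0; rewrite inE js orbT.
rewrite !big_cons hD ?IH ?F0 ?mem_head // big_seq.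
by elim/big_rec: _ => // j x /Fs; exact: addv_ge0.
Qed.

Definition partition_of x s := (forall z, z \in s -> 0 <= z) /\ \sum_(z <- s) z = x.

Fixpoint subsum s y :=
  if s is z :: s' then subsum s' y \/ exists y', subsum s' y' /\ y = z + y'
  else y = 0.

(** Riesz decomposition cuts each block [z] into [a] and [z - a], the pieces [a] adding up to [y].
    By the last clause, elements resolved earlier stay resolved. *)
Lemma partition_split x s y : partition_of x s -> 0 <= y -> y <= x ->
  exists s', [/\ partition_of x s', subsum s' y
    & forall y', subsum s y' -> subsum s' y'].
Proof.
move=> [+ <-]; elim: s y => [|z s IH] y s0 y0.
  rewrite big_nil => yle; exists [::]; split => //=.
    by split => //; rewrite big_nil.
  by apply/eqP; rewrite eq_le yle y0.
have z0 : 0 <= z by apply: s0; rewrite mem_head.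
have s0' w : w \in s -> 0 <= w by move=> ws; apply: s0; rewrite inE ws orbT.
have sum0 : 0 <= \sum_(w <- s) w.
  by rewrite big_seq; elim/big_rec: _ => // w v /s0'; exact: addv_ge0.
rewrite big_cons => /(riesz_decomposition_ge0 z0 sum0 y0)[a [b [yab a0 az b0 bs]]].
have [s' [[s'0 s's] s'b sub]] := IH b s0' b0 bs.
exists [:: a, z - a & s']; split.
- split; last by rewrite !big_cons s's addrA (addrC a) subrK.
  by move=> w; rewrite !inE => /or3P[/eqP->|/eqP->|/s'0//]; rewrite ?subv_ge0.
- by right; exists b; split => //; left.
move=> y' /= [ys|[y2 [ys ->]]]; first by left; left; exact: sub.
right; exists (z - a + y2); split; last by rewrite addrA (addrC a) subrK.
by right; exists y2; split => //; exact: sub.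
Qed.

Lemma subsum_norm_le (f : dual E) s y : subsum s y ->
  `|f y : R| <= \sum_(z <- s) `|f z : R|.
Proof.
elim: s y => [|z s IH] y /=; first by move=> ->; rewrite big_nil raddf0 normr0.
rewrite big_cons => -[/IH|[y' [/IH le ->]]].
  by move=> /le_trans; apply; rewrite lerDr.
by rewrite raddfD (le_trans (ler_normD _ _)) // lerD2l.
Qed.

(* Junk value: [f z * g z / h z = 0] when [h z = 0], which is the right
   convention as [f] and [g] vanish there. *)
Definition gram (h : E -> R) s (f g : dual E) : R :=
  \sum_(z <- s) (f z : R) * (g z : R) / h z.

Lemma gramC h s f g : gram h s f g = gram h s g f.
Proof. by apply: eq_bigr => z _; rewrite mulrAC [in RHS]mulrAC mulrC mulrA mulrAC. Qed.

Lemma gramDl h s f g k : gram h s (f + g) k = gram h s f k + gram h s g k.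
Proof. by rewrite -big_split /=; apply: eq_bigr => z _; rewrite -!mulrDl. Qed.

Lemma gramZl h s (a : R) f g : gram h s (a *: f) g = a * gram h s f g.
Proof.
rewrite /gram mulr_sumr; apply: eq_bigr => z _; rewrite !mulrA.
by [].
Qed.

Lemma gramDr h s f g k : gram h s k (f + g) = gram h s k f + gram h s k g.
Proof. by rewrite gramC gramDl !(gramC _ _ k). Qed.

Lemma gramZr h s (a : R) f g : gram h s g (a *: f) = a * gram h s g f.
Proof. by rewrite gramC gramZl !(gramC _ _ g). Qed.

Lemma gramBl h s f g k : gram h s (f - g) k = gram h s f k - gram h s g k.
Proof. by rewrite gramDl -[- g]scaleN1r gramZl mulN1r. Qed.

Lemma gramBr h s f g k : gram h s k (f - g) = gram h s k f - gram h s k g.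
Proof. by rewrite gramC gramBl !(gramC _ _ k). Qed.

Lemma gram_le h x s (f g : dual E) (a b : R) : cone_functional h ->
  partition_of x s -> 0 <= a -> 0 <= b ->
  (forall z, 0 <= z -> `|f z : R| <= a * h z) ->
  (forall z, 0 <= z -> `|g z : R| <= b * h z) ->
  `|gram h s f g| <= a * b * h x.
Proof.
move=> hh [s0 <-] a0 b0 fh gh; have [_ h0 _ _] := hh.
rewrite (le_trans (ler_norm_sum _ _ _)) // cone_functional_sum // mulr_sumr.
rewrite [leLHS]big_seq [leRHS]big_seq; apply: ler_sum => z /s0 z0.
have := h0 z z0; rewrite le_eqVlt => /predU1P[<-|hz].
  by rewrite invr0 !mulr0 normr0.
rewrite normrM normfV (gtr0_norm hz) ler_pdivrMr // normrM.
rewrite (_ : a * b * h z * h z = (a * h z) * (b * h z)); last first.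
  by rewrite -!mulrA; congr (_ * _); rewrite mulrCA.
by rewrite ler_pM ?fh ?gh.
Qed.

(** Termwise [2 |f z| <= t (f z)^2 / h z + h z / t], by completing a square; where [h z = 0], also
    [f z = 0]. The free [t] stands in for a Cauchy-Schwarz square root. *)
Lemma subsum_gram_le h x s (f : dual E) y (a t : R) : cone_functional h ->
  partition_of x s -> subsum s y -> 0 < t ->
  (forall z, 0 <= z -> `|f z : R| <= a * h z) ->
  2 * `|f y : R| <= t * gram h s f f + h x / t.
Proof.
move=> hh [s0 <-] sy t0 fh; have [_ h0 _ _] := hh.
apply: (@le_trans _ _ (2 * \sum_(z <- s) `|f z : R|)).
  by rewrite ler_wpM2l // subsum_norm_le.
rewrite cone_functional_sum // mulr_suml !mulr_sumr -big_split /=.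
rewrite [leLHS]big_seq [leRHS]big_seq; apply: ler_sum => z /s0 z0.
have := h0 z z0; rewrite le_eqVlt => /predU1P[hz|hz].
  have := fh z z0; rewrite -hz mulr0 normr_le0 => /eqP ->.
  by rewrite normr0 !(mul0r, mulr0) addr0.
rewrite -subr_ge0; set c := (f z : R).
have -> : t * (c * c / h z) + h z / t - 2 * `|c| =
    (t * `|c| - h z) ^+ 2 / (t * h z).
  have -> : c * c = `|c| * `|c| by rewrite -normrM ger0_norm // -expr2 sqr_ge0.
  by field; rewrite !gt_eqF.
by rewrite divr_ge0 ?sqr_ge0 // mulr_ge0 // ltW.
Qed.

End partitions.

(** * Limit Gram forms and Bessel's inequality *)

Section weak_limits.
Context {R : realType} {E : banachLatticeType R}.
Context (h : E -> R) (x : E).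
Hypotheses (hh : cone_functional h) (x0 : 0 <= x).

Lemma exists_partition (s : seq E) :
  exists p, partition_of x p /\
    forall y, y \in s -> 0 <= y -> y <= x -> subsum p y.
Proof.
elim: s => [|y s [p [px ps]]].
  exists [:: x]; split => //; split; last by rewrite big_seq1.
  by move=> z; rewrite inE => /eqP->.
have [/andP[y0 yx]|yx] := boolP ((0 <= y) && (y <= x)); last first.
  exists p; split => // z; rewrite inE => /predU1P[->|/ps//] z0 zx.
  by rewrite z0 zx in yx.
have [p' [p'x p'y pp']] := partition_split px y0 yx.
exists p'; split => // z; rewrite inE => /predU1P[->//|zs] z0 zx.
exact/pp'/ps.
Qed.

(** The partitions resolving a prescribed finite list of points form a filter base, since lists can
    be concatenated; an ultrafilter containing it resolves each point of [[0, x]]. *)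
Lemma partition_ultrafilter : exists V : set_system (seq E),
  UltraFilter V /\ V (partition_of x) /\
  forall y, 0 <= y -> y <= x -> V [set p | subsum p y].
Proof.
pose B (s : seq E) : set (seq E) := [set p | partition_of x p /\
    forall y, y \in s -> 0 <= y -> y <= x -> subsum p y].
have FF : ProperFilter (filter_from [set: seq E] B).
  apply: filter_from_proper; last by move=> s _; exact: exists_partition.
  apply: filter_from_filter; first by exists [::].
  move=> s t _ _; exists (s ++ t) => // p [px ps]; split; split => // y ys.
    by apply: ps; rewrite mem_cat ys.
  by apply: ps; rewrite mem_cat ys orbT.
have [V [UV FV]] := ultraFilterLemma FF; exists V; split => //; split.
  by apply: FV; exists [::] => // p [].
move=> y y0 yx; apply: FV; exists [:: y] => // p [_]; apply => //.
exact: mem_head.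
Qed.

Variable f : nat -> dual E.
Hypothesis fh : forall n z, 0 <= z -> `|f n z : R| <= h z.

(** [G i j] is the limit of [gram h s (f i) (f j)] along the ultrafilter. Only finitely many
    conditions occur at a time, so one partition [s] meets them all. *)
Lemma gram_limit : exists G : nat -> nat -> R,
  forall N e y, 0 < e -> 0 <= y -> y <= x ->
  exists s, [/\ partition_of x s, subsum s y &
    forall i j, (i < N)%N -> (j < N)%N -> `|gram h s (f i) (f j) - G i j| < e].
Proof.
have [V [UV [Vx Vy]]] := partition_ultrafilter.
have h1 n z : 0 <= z -> `|f n z : R| <= 1 * h z by rewrite mul1r; exact: fh.
(* Off the partitions of [x] the value 0 keeps [a i j] bounded by [h x]. *)
pose a (i j : nat) (s : seq E) :=
  if `[< partition_of x s >] then gram h s (f i) (f j) else 0.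
have aM i j s : `|a i j s| <= h x.
  have [_ h0 _ _] := hh.
  rewrite /a; case: asboolP => [px|_]; last by rewrite normr0 h0.
  by have := gram_le hh px ler01 ler01 (h1 i) (h1 j); rewrite !mul1r.
have /choice[G GP] (ij : nat * nat) : exists l : R,
    forall e, 0 < e -> V [set s | `|a ij.1 ij.2 s - l| < e].
  by apply: ultra_bounded_cvg => s; exact: aM.
exists (fun i j => G (i, j)) => N e y e0 y0 yx.
have : V (partition_of x `&` [set s | subsum s y] `&`
    [set s | forall ij : 'I_N * 'I_N, `|a ij.1 ij.2 s - G (val ij.1, val ij.2)| < e]).
  apply: filterI; first by apply: filterI => //; exact: Vy.
  by apply: filter_forall => ij; exact: (GP (val ij.1, val ij.2)).
move=> /filter_ex[s [[px sy] sG]]; exists s; split => // i j iN jN.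
have := sG (Ordinal iN, Ordinal jN); rewrite /a /=.
by case: asboolP.
Qed.

(** The upper half of Bessel's inequality, by expanding the square: a diagonal term is at most
    [4 * h x * c k ^+ 2], and the [k] pairs [j < k], each counted twice, contribute at most
    [2 * M ^+ 2 * (k%:R * e k)]. *)
Lemma gram_sum_le s (g : nat -> dual E) (c e : nat -> R) (M : R) K :
  partition_of x s -> (forall k z, 0 <= z -> `|g k z : R| <= 2 * h z) ->
  (forall k, `|c k| <= M) ->
  (forall j k, (j < k < K)%N -> `|gram h s (g j) (g k)| <= e k) ->
  gram h s (\sum_(k < K) c k *: g k) (\sum_(k < K) c k *: g k) <=
    4 * h x * (\sum_(k < K) c k ^+ 2) + 2 * M ^+ 2 * \sum_(k < K) k%:R * e k.
Proof.
move=> px gh cM; elim: K => [|K IH] ge.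
  rewrite !big_ord0 !mulr0 addr0 /gram big1 // => z _.
  by rewrite [X in X * _](_ : _ = 0) ?mul0r.
rewrite !big_ord_recr /=; set S := \sum_(k < K) _ in IH *.
have M0 : 0 <= M by exact: le_trans (cM 0).
have gSg : `|gram h s S (g K)| <= M * (K%:R * e K).
  have -> : gram h s S (g K) = \sum_(k < K) c k * gram h s (g k) (g K).
    rewrite /S; elim/big_rec2: _ => [|k y1 y2 _ <-]; last by rewrite gramDl gramZl.
    by rewrite /gram big1 // => z _; rewrite [X in X * _](_ : _ = 0) ?mul0r.
  rewrite (le_trans (ler_norm_sum _ _ _)) //.
  have -> : M * (K%:R * e K) = \sum_(k < K) M * e K.
    by rewrite sumr_const card_ord -[RHS]mulr_natl mulrCA.
  apply: ler_sum => k _; rewrite normrM.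
  by apply: ler_pM (normr_ge0 _) (normr_ge0 _) (cM _) _; rewrite ge // ltn_ord leqnn.
have gg : gram h s (g K) (g K) <= 4 * h x.
  have := gram_le hh px (ler0n _ 2) (ler0n _ 2) (gh K) (gh K).
  by rewrite -natrM => /(le_trans (ler_norm _)).
have {}IH : gram h s S S <=
    4 * h x * (\sum_(k < K) c k ^+ 2) + 2 * M ^+ 2 * \sum_(k < K) k%:R * e k.
  by apply: IH => j k /andP[jk kK]; rewrite ge // jk ltnS ltnW.
rewrite !gramDl !gramDr !gramZl !gramZr (gramC _ _ (g K) S).
have cgS : c K * gram h s S (g K) <= M ^+ 2 * (K%:R * e K).
  rewrite (le_trans (ler_norm _)) // normrM expr2 -mulrA.
  exact: ler_pM (normr_ge0 _) (normr_ge0 _) (cM _) gSg.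
have cg : c K * (c K * gram h s (g K) (g K)) <= 4 * h x * c K ^+ 2.
  by rewrite mulrA -expr2 mulrC ler_wpM2r ?sqr_ge0.
rewrite [leRHS](_ : _ = (4 * h x * (\sum_(k < K) c k ^+ 2) +
   2 * M ^+ 2 * \sum_(k < K) k%:R * e k) +
   (M ^+ 2 * (K%:R * e K) + M ^+ 2 * (K%:R * e K)) + 4 * h x * c K ^+ 2).
  by lra.
by ring.
Qed.

Lemma square_summable_cvg0 (c : nat -> R) (C : R) :
  (forall K, \sum_(k < K) c k ^+ 2 <= C) -> c @ \oo --> (0 : R).
Proof.
move=> cC; have : cvgn (series (fun k => c k ^+ 2)).
  apply: nondecreasing_is_cvgn.
    by apply/nondecreasing_seqP => n; rewrite seriesSr lerDl sqr_ge0.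
  by exists C => _ [K _ <-]; rewrite /series /= big_mkord.
move=> /cvg_series_cvg_0/cvgrPdist_lt c0; apply/cvgrPdist_lt => e e0.
have e20 : 0 < e ^+ 2 by rewrite exprn_gt0.
apply: filterS (c0 _ e20) => n; rewrite !sub0r !normrN.
by rewrite normrX ltr_pXn2r ?nnegrE // ltW.
Qed.

Lemma geometric_half_le K : \sum_(k < K) (2 ^ k)%:R^-1 <= 2 :> R.
Proof.
suff -> : \sum_(k < K) (2 ^ k)%:R^-1 = 2 - 2 * (2 ^ K)%:R^-1 :> R.
  by rewrite lerBlDr lerDl mulr_ge0 // invr_ge0.
elim: K => [|K IH]; first by rewrite big_ord0 expn0 invr1 mulr1 subrr.
rewrite big_ord_recr /= IH expnS natrM invfM; lra.
Qed.

(** [b i] is the limit of [G i n] in [n]. If [G i j] is close to [b i] for [i] in an earlier pair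
    and [j] in a later one, the [b i] cancel in the Gram entries of the differences, which are thus
    almost orthogonal; Bessel's inequality makes their values at [y] square summable. *)
Lemma weakly_null_differences : exists p : nat -> nat * nat,
  (forall k, ((p k).1 < (p k).2)%N) /\ (forall y, 0 <= y -> y <= x ->
    (fun k => (f (p k).2 y : R) - f (p k).1 y) @ \oo --> (0 : R)).
Proof.
have [G GP] := gram_limit.
have Gle i j : `|G i j| <= h x + 1.
  have [s [px _ sG]] := GP (maxn i j).+1 1 0 ltr01 (lexx _) x0.
  have := sG i j; rewrite !ltnS leq_maxl leq_maxr => /(_ isT isT) ijG.
  have h1 n z : 0 <= z -> `|f n z : R| <= 1 * h z by rewrite mul1r; exact: fh.
  have := gram_le hh px ler01 ler01 (h1 i) (h1 j); rewrite !mul1r => gle.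
  have := ler_distD (gram h s (f i) (f j)) (G i j) 0.
  by rewrite !subr0 distrC; move: ijG gle; lra.
have [U [UU Uoo]] := @ultraFilterLemma nat \oo _.
have /choice[b bP] i : exists l : R, forall e, 0 < e -> U [set n | `|G i n - l| < e].
  exact: ultra_bounded_cvg.
(* The factor [k.+1] absorbs the [k] earlier indices in [gram_sum_le] and leaves a geometric
   series. *)
pose eta k : R := (k.+1 * 2 ^ k)%:R^-1.
have eta0 k : 0 < eta k by rewrite invr_gt0 ltr0n muln_gt0 expn_gt0.
pose S k (p q : nat * nat) := forall i j, i \in [:: p.1; p.2] ->
  j \in [:: q.1; q.2] -> `|G i j - b i| < eta k.
have [|p [pQ pS]] := @greedy_sequence (nat * nat) (0%N, 0%N) (fun p => (p.1 < p.2)%N) S.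
  move=> n u _.
  have Un : U [set j | forall i : 'I_n,
      `|G (u i).1 j - b (u i).1| < eta n /\ `|G (u i).2 j - b (u i).2| < eta n].
    by apply: filter_forall => i; apply: filterI; exact: bP.
  have [j1 j1P] := filter_ex Un.
  have [j2 [j2P j12]] : exists j, _ := filter_ex (filterI Un (Uoo _ (nbhs_infty_gt j1))).
  exists (j1, j2); split => // i ni k j.
  have [a1 a2] := j1P (Ordinal ni); have [b1 b2] := j2P (Ordinal ni).
  by rewrite !inE => /orP[]/eqP-> /orP[]/eqP->.
exists p; split => // y y0 yx; set c := (fun k => _ : R).
pose H := h x + 1; have [_ hge0 _ _] := hh.
have H0 : 0 < H by rewrite ltr_wpDl ?hge0.
pose g k : dual E := f (p k).2 - f (p k).1.
have gE k z : (g k z : R) = (f (p k).2 z : R) - f (p k).1 z by [].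
have gh k z : 0 <= z -> `|g k z : R| <= 2 * h z.
  move=> z0; rewrite gE (le_trans (ler_normB _ _)) //.
  by have := fh (p k).2 z0; have := fh (p k).1 z0; lra.
have cM k : `|c k| <= 2 * H.
  rewrite /c -gE (le_trans (gh _ _ y0)) //.
  by have := cone_functional_le hh y0 yx; rewrite /H; lra.
apply: (@square_summable_cvg0 _ (64 * H + 4 * H ^+ 2)) => K.
have [N pN] : exists N, forall k, (k < K)%N -> ((p k).2 < N)%N.
  exists (\sum_(k < K) (p k).2).+1 => k kK.
  by rewrite ltnS (bigD1 (Ordinal kK)) //= leq_addr.
have pN1 k : (k < K)%N -> ((p k).1 < N)%N.
  by move=> kK; exact: ltn_trans (pQ k) (pN k kK).
have [s [px sy sG]] := GP N (eta K) y (eta0 K) y0 yx.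
have eta_le k : (k < K)%N -> eta K <= eta k.
  move=> kK; rewrite lef_pV2 ?posrE ?ltr0n ?muln_gt0 ?expn_gt0 // ler_nat.
  by rewrite leq_mul ?ltnS ?leq_exp2l // ltnW.
have gg j k : (j < k < K)%N -> `|gram h s (g j) (g k)| <= 8 * eta k.
  move=> /andP[jk kK]; have jK := ltn_trans jk kK.
  have pjk := pS _ _ jk.
  have G2 i l : i \in [:: (p j).1; (p j).2] -> l \in [:: (p k).1; (p k).2] ->
      `|gram h s (f i) (f l) - b i| <= 2 * eta k.
    move=> ij lk; have := pjk _ _ ij lk; have := eta_le k kK.
    have : `|gram h s (f i) (f l) - G i l| < eta K.
      apply: sG; [move: ij|move: lk]; rewrite !inE => /orP[]/eqP->; by auto.
    by have := ler_distD (G i l) (gram h s (f i) (f l)) (b i); lra.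
  have gE' : gram h s (g j) (g k) =
      gram h s (f (p j).2) (f (p k).2) - gram h s (f (p j).2) (f (p k).1)
      - (gram h s (f (p j).1) (f (p k).2) - gram h s (f (p j).1) (f (p k).1)).
    by rewrite /g gramBl !gramBr.
  have := G2 (p j).1 (p k).1; have := G2 (p j).1 (p k).2.
  have := G2 (p j).2 (p k).1; have := G2 (p j).2 (p k).2.
  rewrite !inE !eqxx !orbT gE' => /(_ isT isT) + /(_ isT isT) + /(_ isT isT) + /(_ isT isT).
  by rewrite !ler_norml; lra.
have := gram_sum_le px gh cM gg.
set Q := gram _ _ _ _; set sg := \sum_(k < K) _; set t := \sum_(k < K) _ => Qle.
have tle : t <= 16.
  rewrite (_ : 16 = 8 * 2); last by lra.
  apply: (@le_trans _ _ (8 * \sum_(k < K) (2 ^ k)%:R^-1)); last first.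
    by rewrite ler_wpM2l // geometric_half_le.
  rewrite mulr_sumr; apply: ler_sum => k _; rewrite mulrCA ler_wpM2l //.
  rewrite /eta natrM invfM mulrA ler_piMl ?invr_ge0 //.
  by rewrite ler_pdivrMr ?ltr0n // mul1r ler_nat.
have gS z : 0 <= z -> `|(\sum_(k < K) c k *: g k : dual E) z : R| <=
    (\sum_(k < K) `|c k| * 2) * h z.
  move=> z0; elim: (K) => [|n IH].
    by rewrite !big_ord0 mul0r [X in `|X|](_ : _ = 0) ?normr0.
  rewrite !big_ord_recr /= mulrDl (le_trans (ler_normD _ _)) // lerD //.
  by rewrite normrM -mulrA ler_wpM2l // gh.
(* With this [t] the diagonal part [4 * H * sg] of [Q] costs one of the two [sg] on the left; what
   remains bounds [sg] independently of [K]. *)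
have := subsum_gram_le (t := (4 * H)^-1) hh px sy _ gS.
rewrite invr_gt0 mulr_gt0 // => /(_ isT).
have -> : ((\sum_(k < K) c k *: g k : dual E) y : R) = sg.
  rewrite /sg; elim: (K) => [|n IH]; first by rewrite !big_ord0.
  by rewrite !big_ord_recr /= -IH expr2.
rewrite -/Q invrK => sgle.
have sg0 : 0 <= sg by apply: sumr_ge0 => k _; rewrite sqr_ge0.
have hH : h x <= H by rewrite lerDl.
have hx0 := hge0 _ x0.
have Qle' : Q <= 4 * H * sg + 128 * H ^+ 2.
  apply: (le_trans Qle); apply: lerD; first by rewrite ler_wpM2r // ler_wpM2l.
  apply: (@le_trans _ _ (2 * (2 * H) ^+ 2 * 16)).
    by rewrite ler_wpM2l // mulr_ge0 // sqr_ge0.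
  by rewrite le_eqVlt; apply/orP; left; apply/eqP; ring.
have : (4 * H)^-1 * Q <= sg + 32 * H.
  rewrite mulrC ler_pdivrMr ?mulr_gt0 // (le_trans Qle') //.
  by rewrite le_eqVlt; apply/orP; left; apply/eqP; ring.
have : h x * (4 * H) <= 4 * H ^+ 2.
  by rewrite (_ : 4 * H ^+ 2 = H * (4 * H)) ?ler_wpM2r ?mulr_ge0 //; [rewrite ltW|ring].
move: sgle; rewrite (ger0_norm sg0); have := sqr_ge0 H; lra.
Qed.

End weak_limits.

(** * Dominated functionals and limited order intervals *)

Section dual_facts.
Context {R : realType}.

Lemma dual_of_linear (V : normedModType R) (f : V -> R) (M : R) :
  linear (f : V -> R^o) -> (forall x, `|f x| <= M * `|x|) ->
  exists g : dual V, forall x, g x = f x.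
Proof.
move=> lf fM; have df : (f : V -> R^o) \in @dual_pred R V.
  by apply/asboolP; split => //; exists M.
by exists (Dual df).
Qed.

Lemma weak_star_nullP (X : normedModType R) (f : nat -> dual X) :
  (forall x, (fun n => f n x : R) @ \oo --> (0 : R)) -> weak_star_null f.
Proof.
move=> f0; rewrite /weak_star_null cvg_sup => x.
rewrite cvg_image; last by rewrite eqEsubset; split=> v // _; exists (cst v).
apply: cvg_trans (f0 x) => W /= fW; exists (@^~ x @^-1` W) => //.
by rewrite image_preimage // eqEsubset; split=> // v _; exists (cst v).
Qed.

Lemma limited_uniform (X : completeNormedModType R) (C : set X)
    (f : nat -> dual X) (e : R) : limited C ->
  (forall x, (fun n => f n x : R) @ \oo --> (0 : R)) -> 0 < e ->
  \forall n \near \oo, forall x, C x -> `|f n x : R| < e.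
Proof.
move=> [_ limC] /weak_star_nullP/limC f0 e0.
have /f0 : nbhs (cst 0 : {uniform` C -> R}) [set g | forall x, C x -> `|g x| < e].
  apply/uniform_nbhs; exists [set xy | ball xy.1 e xy.2]; split.
    by rewrite -entourage_ballE; exists e.
  by move=> g /= gC x /gC; rewrite -ball_normE /= sub0r normrN.
by [].
Qed.

End dual_facts.

Section norming_functionals.
Context {R : realType}.

Lemma linear_le_norm_abs (V : lmodType R) (g : V -> R) (q : V -> R) :
  linear (g : V -> R^o) -> (forall z, q (- z) = q z) -> (forall z, g z <= q z) ->
  forall z, `|g z| <= q z.
Proof.
move=> lg qN gq z; rewrite ler_norml gq andbT lerNl -qN.
have -> : - g z = g (- z); last exact: gq.
have := lg (-1) z 0; rewrite addr0 scaleN1r => ->.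
have := lg 1 0 0; rewrite scaler0 addr0 scale1r => g0.
have -> : g 0 = 0 by apply: (addrI (g 0)); rewrite addr0 -g0.
by rewrite addr0 scaleN1r.
Qed.

Lemma seminorm_functional (V : normedModType R) (q : V -> R) (v : V) :
  sublinear q -> (forall z, q (- z) = q z) -> (forall z, q z <= `|z|) ->
  exists f : dual V, (forall z, `|f z : R| <= q z) /\ f v = q v.
Proof.
move=> sq qN qle; have [g [lg gq gv]] := hahn_banach v sq.
have gabs := linear_le_norm_abs lg qN gq.
have [|f fg] := @dual_of_linear _ V g 1 lg.
  by move=> z; rewrite mul1r (le_trans (gabs z)).
by exists f; split => [z|]; rewrite fg.
Qed.

Lemma norm_sublinear (V : normedModType R) : sublinear (fun z : V => `|z|).
Proof.
split=> [//|x y|t x t0]; first exact: ler_normD.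
by rewrite normrZ gtr0_norm.
Qed.

Lemma norming_functional (V : normedModType R) (v : V) :
  exists f : dual V, (forall z, `|f z : R| <= `|z|) /\ f v = `|v|.
Proof. by apply: seminorm_functional (norm_sublinear V) _ _ => // z; rewrite normrN. Qed.

Lemma dual_comp (V W : normedModType R) (T : {linear V -> W}) (f : dual W) :
  bounded_operator T -> (forall z, `|f z : R| <= `|z|) ->
  exists g : dual V, forall z, g z = f (T z).
Proof.
move=> [M TM] f1; apply: (@dual_of_linear _ V (fun z => f (T z)) M).
  by move=> a u v; rewrite !linearP.
by move=> z; exact: le_trans (f1 _) (TM z).
Qed.

End norming_functionals.

(** * Localization of a functional to an order ideal *)

Section localization.
Context {R : realType} {E : banachLatticeType R}.
Context (h : E -> R) (x : E).
Hypotheses (hh : cone_functional h) (x0 : 0 <= x).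
Implicit Types v w y z : E.

Lemma meetD_le u v w : 0 <= u -> 0 <= v -> 0 <= w ->
  (Order.meet (u + v) w : E) <= Order.meet u w + Order.meet v w.
Proof.
move=> u0 v0 w0; rewrite -levBl lexI; apply/andP; split.
  rewrite levBl (addrC u (Order.meet _ _)) -levBl lexI; apply/andP; split.
    by rewrite levBl (addrC v) leIl.
  by rewrite (le_trans (subv_le _ u0)) // leIr.
by rewrite (le_trans (subv_le _ _)) ?leIr // lexI v0.
Qed.

(* The part of [h] carried by the order ideal generated by [x]. *)
Definition localize v : R :=
  sup [set h (Order.meet (vabs v) (c *: x)) | c in [set c | 0 <= c]].

Let meet_ge0 v c : 0 <= c -> 0 <= Order.meet (vabs v) (c *: x).
Proof. by move=> c0; rewrite lexI vabs_ge0 scalev_ge0. Qed.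

Lemma localize_ub v c : 0 <= c -> h (Order.meet (vabs v) (c *: x)) <= localize v.
Proof.
move=> c0; apply: ub_le_sup; last by exists c.
exists (h (vabs v)) => _ [d /= d0 <-].
by apply: (cone_functional_le hh); rewrite ?meet_ge0 ?leIl.
Qed.

Lemma localize_le v M :
  (forall c, 0 <= c -> h (Order.meet (vabs v) (c *: x)) <= M) -> localize v <= M.
Proof.
move=> vM; apply: ge_sup => [|_ [c /= c0 <-]]; last exact: vM.
by exists (h (Order.meet (vabs v) (0 *: x))), 0 => /=.
Qed.

Lemma localize_le_vabs v : localize v <= h (vabs v).
Proof.
apply: localize_le => c c0.
by apply: (cone_functional_le hh); rewrite ?meet_ge0 ?leIl.
Qed.

Lemma vabs_le_localize v c : 0 <= c -> vabs v <= c *: x -> h (vabs v) <= localize v.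
Proof. by move=> c0 /meet_l <-; exact: localize_ub. Qed.

Lemma localizeN v : localize (- v) = localize v.
Proof. by rewrite /localize vabsN. Qed.

Lemma localize_sublinear : sublinear localize.
Proof.
have [hD h0 hZ _] := hh; split.
- by rewrite (le_trans _ (localize_ub _ (lexx 0))) // h0 // meet_ge0.
- move=> v w; apply: localize_le => c c0.
  apply: le_trans (lerD (localize_ub v c0) (localize_ub w c0)).
  rewrite -hD ?meet_ge0 //; apply: (cone_functional_le hh); first exact: meet_ge0.
  apply: le_trans (meetD_le (vabs_ge0 _) (vabs_ge0 _) (scalev_ge0 c0 x0)).
  by rewrite leI2 ?vabsD.
- move=> t v t0; apply: localize_le => c c0.
  have tc0 : 0 <= t^-1 * c by rewrite mulr_ge0 // invr_ge0 ltW.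
  rewrite (le_trans _ (ler_wpM2l (ltW t0) (localize_ub v tc0))) //.
  rewrite -hZ ?(ltW t0) ?meet_ge0 //; apply: (cone_functional_le hh); rewrite ?meet_ge0 //.
  have tK z : z = t *: (t^-1 *: z) by rewrite scalerA divff ?gt_eqF // scale1r.
  rewrite [leLHS]tK scalev_le ?(ltW t0) // lexI; apply/andP; split; last first.
    by rewrite -scalerA scalev_le ?leIr // invr_ge0 (ltW t0).
  rewrite [leRHS](_ : _ = t^-1 *: (t *: vabs v)); last first.
    by rewrite scalerA mulVf ?gt_eqF // scale1r.
  by rewrite scalev_le ?invr_ge0 ?(ltW t0) // (le_trans (leIl _ _)) // vabsZ // ltW.
Qed.

(** Take [c] almost attaining the supremum and [m] the meet of [y] and [(c + 1) x]. The part of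
    [y - m] below [d x] adds to [m] below both [y] and [(d + c + 1) x], so [h] is at most [e] there.
    Adding 1 makes the constant positive. *)
Lemma localize_tail y (e : R) : 0 <= y -> 0 < e ->
  exists2 c : R, 0 < c & localize (y - Order.meet y (c *: x)) <= e.
Proof.
move=> y0 e0; have [hD h0 _ _] := hh.
have [_ [c /= c0 <-] cy] : exists2 r,
    [set h (Order.meet (vabs y) (c *: x)) | c in [set c | 0 <= c]] r &
    localize y - e < r.
  apply: sup_adherent => //; split.
    by exists (h (Order.meet (vabs y) (0 *: x))), 0 => /=.
  exists (localize y) => _ [d /= d0 <-]; exact: localize_ub.
have c10 : 0 < c + 1 by rewrite ltr_wpDl.
exists (c + 1) => //; apply: localize_le => d d0.
have my0 : 0 <= Order.meet y ((c + 1) *: x) by rewrite lexI y0 scalev_ge0 // ltW.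
rewrite ge0_vabs ?subv_ge0 ?leIl //.
set m := Order.meet y _ in my0 *; set w := Order.meet (y - m) _.
have w0 : 0 <= w by rewrite lexI subv_ge0 leIl scalev_ge0.
have cd0 : 0 <= d + (c + 1) by rewrite addr_ge0 // ltW.
have := localize_ub y cd0; rewrite (ge0_vabs y0).
have : h (w + m) <= h (Order.meet y ((d + (c + 1)) *: x)).
  apply: (cone_functional_le hh); first exact: addv_ge0.
  rewrite lexI -[X in _ + _ <= X](subrK m) levD ?leIl //= scalerDl levD ?leIr //.
have : h (Order.meet (vabs y) (c *: x)) <= h m.
  apply: (cone_functional_le hh); rewrite ?meet_ge0 // (ge0_vabs y0) leI2 //.
  by rewrite scalev_lel // lerDl.
rewrite hD //; move: cy; lra.
Qed.

End localization.

(** * Total boundedness from limited order intervals *)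

Section limited_intervals.
Context {R : realType} {E : banachLatticeType R}.
Hypothesis limited_intervals : forall a b : E, limited `[a, b].

(** Hahn-Banach for the seminorm [localize h x]. This bound, sharper than [h (vabs z)], lets weak*
    nullity be tested on [[0, x]]. *)
Lemma dominated_functional (h : E -> R) (x v : E) : cone_functional h -> 0 <= x ->
  exists f : dual E, (forall z, `|f z : R| <= localize h x z) /\
    f v = localize h x v.
Proof.
move=> hh x0; have sl := localize_sublinear hh x0.
have [g [lg gq gv]] := hahn_banach v sl.
have gabs := linear_le_norm_abs lg (localizeN h x) gq.
have [_ _ _ [M hM]] := hh.
have [|f fg] := @dual_of_linear _ E g M lg.
  move=> z; rewrite (le_trans (gabs z)) // (le_trans (localize_le_vabs hh x0 z)) //.
  by rewrite (le_trans (hM _ (vabs_ge0 z))) // normv_vabs.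
by exists f; split => [z|]; rewrite fg.
Qed.

(* Weak* nullity on the order ideal of [x] propagates to [E] because the
   functionals are dominated by the localization of [h] at [x]. *)
Lemma dominated_weak_star_null (h : E -> R) (x : E) (f : nat -> dual E) (M : R) :
  cone_functional h -> 0 <= x -> 0 < M ->
  (forall n z, `|f n z : R| <= M * localize h x z) ->
  (forall y, 0 <= y -> y <= x -> (fun n => f n y : R) @ \oo --> (0 : R)) ->
  forall y, (fun n => f n y : R) @ \oo --> (0 : R).
Proof.
move=> hh x0 M0 fq fx.
have pos y : 0 <= y -> (fun n => f n y : R) @ \oo --> (0 : R).
  move=> y0; apply/cvgrPdist_lt => e e0; have e20 : 0 < e / 2 / M by rewrite !divr_gt0.
  have [c c0 yc] := localize_tail hh x0 y0 e20.
  set m := Order.meet y (c *: x) in yc.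
  have cm0 : 0 <= c^-1 *: m.
    by rewrite scalev_ge0 ?lexI ?y0 ?scalev_ge0 ?invr_ge0 // ltW.
  have cmx : c^-1 *: m <= x.
    rewrite [leRHS](_ : _ = c^-1 *: (c *: x)); last first.
      by rewrite scalerA mulVf ?scale1r // gt_eqF.
    by rewrite scalev_le ?leIr // invr_ge0 ltW.
  have /cvgrPdist_lt := fx _ cm0 cmx.
  have ec0 : 0 < e / 2 / c by rewrite !divr_gt0.
  move=> /(_ _ ec0); apply: filterS => n; rewrite !sub0r !normrN => fm.
  have -> : (f n y : R) = f n (y - m) + c * f n (c^-1 *: m).
    by rewrite linearZ /= mulrA divff ?gt_eqF // mul1r -raddfD subrK.
  rewrite (le_lt_trans (ler_normD _ _)) // (splitr e) ler_ltD //.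
    by rewrite (le_trans (fq _ _)) // mulrC -ler_pdivlMr.
  by rewrite normrM (gtr0_norm c0) mulrC -ltr_pdivlMr.
move=> y; rewrite -(vposBN y) -[0](subr0 (0 : R)).
under eq_fun do rewrite raddfB.
by apply: cvgB; apply: pos; exact: vpos_ge0.
Qed.

(** A separated sequence yields [v_n] in [[-X, X]] and dominated [f_n] with [f_n v_n >= e] and
    [|f_i v_n| <= e / 8] for [i < n]. Some differences of the [f_n] are weak* null but exceed
    [e / 2] on the later vector, which limitedness of [[-X, X]] excludes. *)
Lemma limited_intervals_total_boundedness (h : E -> R) (x : E) (y : nat -> E)
    (e : R) : cone_functional h -> 0 <= x -> (forall n, vabs (y n) <= x) -> 0 < e ->
  exists m n, (m < n)%N /\ h (vabs (y m - y n)) < e.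
Proof.
move=> hh x0 yx e0; apply: contrapT => /forallNP ysep.
have {}ysep m n : (m < n)%N -> e <= h (vabs (y m - y n)).
  move=> mn; rewrite leNgt; apply/negP => lt.
  by apply: (ysep m); exists n.
pose X := x + x; have X0 : 0 <= X by exact: addv_ge0.
have yX m n : vabs (y m - y n) <= X.
  by rewrite (le_trans (vabsD _ _)) // vabsN levD.
pose q := localize h X.
have [U [UU Uoo]] := @ultraFilterLemma nat \oo _.
have e160 : 0 < e / 16 by rewrite divr_gt0.
have [|u [uQ uS]] := @greedy_sequence (E * dual E) (0, 0)
  (fun t => [/\ vabs t.1 <= X, e <= t.2 t.1 & forall z, `|t.2 z : R| <= q z])
  (fun _ s t => `|s.2 t.1 : R| <= e / 8).
  move=> n u uQ.
  (* The earlier functionals converge on [y] along [U], so indices [m1 < m2] in one set of [U] make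
     all of them at most [e / 8] on [y m1 - y m2]. *)
  have /choice[l lP] (i : nat) : exists l : R, (i < n)%N ->
      U [set m | `|((u i).2 (y m) : R) - l| < e / 16].
    have [ni|_] := ltnP i n; last by exists 0.
    have [_ _ uq] := uQ i ni.
    have [m|l lP] := @ultra_bounded_cvg R _ U (fun m => (u i).2 (y m)) (h x) UU.
      rewrite (le_trans (uq _)) // (le_trans (localize_le_vabs hh X0 _)) //.
      by apply: (cone_functional_le hh); rewrite ?vabs_ge0.
    by exists l => _; exact: lP.
  have Un : U [set m | forall i : 'I_n, `|((u i).2 (y m) : R) - l i| < e / 16].
    by apply: filter_forall => i; exact: lP.
  have [m1 m1P] := filter_ex Un.
  have [m2 [m2P m12]] : exists m, _ := filter_ex (filterI Un (Uoo _ (nbhs_infty_gt m1))).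
  pose v := y m1 - y m2.
  have [f [fq fv]] := dominated_functional v hh X0.
  exists (v, f); split => /=.
    split; [exact: yX| |exact: fq].
    rewrite [leRHS]fv (le_trans (ysep _ _ m12)) //.
    by apply: (@vabs_le_localize _ _ _ _ hh X0 _ 1); rewrite ?scale1r.
  move=> i ni; have := m1P (Ordinal ni); have := m2P (Ordinal ni) => /=.
  rewrite raddfB /=.
  move: ((u i).2 (y m1) : R) ((u i).2 (y m2) : R) => a b.
  by rewrite !ltr_norml ler_norml; lra.
pose f n := (u n).2.
have fh n z : 0 <= z -> `|f n z : R| <= h z.
  move=> z0; have [_ _ /(_ z)/le_trans] := uQ n; apply.
  by rewrite -[in leRHS](ge0_vabs z0) localize_le_vabs.
have [p [pQ pX]] := weakly_null_differences hh X0 fh.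
pose g k : dual E := f (p k).2 - f (p k).1.
have gE k z : (g k z : R) = (f (p k).2 z : R) - f (p k).1 z by [].
have gq k z : `|g k z : R| <= 2 * q z.
  have [_ _ /(_ z)] := uQ (p k).1; have [_ _ /(_ z)] := uQ (p k).2.
  rewrite gE -/(f (p k).1) -/(f (p k).2).
  by have := ler_normB (f (p k).2 z : R) (f (p k).1 z); lra.
have g0 := dominated_weak_star_null hh X0 (ltr0n R 2) gq pX.
have e20 : 0 < e / 2 by rewrite divr_gt0.
have [k gk] := filter_ex (limited_uniform (limited_intervals (- X) X) g0 e20).
have [vX ev _] := uQ (p k).2; have := uS _ _ (pQ k).
have {}gk : `|g k (u (p k).2).1 : R| < e / 2.
  by apply: gk; rewrite /= in_itv /= -vabs_le.
move: gk; rewrite gE -/(f (p k).1); move: ev; rewrite -/(f (p k).2).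
move: (f _ _ : R) (f _ _ : R) => a b ea.
by rewrite ltr_norml ler_norml; lra.
Qed.

End limited_intervals.

(** * AM-compactness *)

Section absolute_value.
Context {R : realType} {E : banachLatticeType R}.
Implicit Types (f : dual E) (u v z : E).

Definition dual_abs f u : R := sup [set (f z : R) | z in [set z | vabs z <= u]].

Lemma dual_abs_has_sup f u : 0 <= u ->
  has_sup [set (f z : R) | z in [set z | vabs z <= u]].
Proof.
move=> u0; split.
  by exists (f 0), 0 => //=; rewrite ge0_vabs.
have [M fM] := dual_bounded f; exists (`|M| * `|u|) => _ [z /= zu <-].
rewrite (le_trans (ler_norm _)) // (le_trans (fM z)) //.
rewrite (le_trans (ler_wpM2r _ (ler_norm M))) // ler_wpM2l //.
exact: normv_le.
Qed.

Lemma dual_abs_ub f u z : 0 <= u -> vabs z <= u -> (f z : R) <= dual_abs f u.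
Proof. by move=> u0 zu; apply: (sup_upper_bound (dual_abs_has_sup f u0)); exists z. Qed.

Lemma dual_abs_le f u (M : R) : 0 <= u ->
  (forall z, vabs z <= u -> (f z : R) <= M) -> dual_abs f u <= M.
Proof.
move=> u0 fM; apply: ge_sup; first by have [] := dual_abs_has_sup f u0.
by move=> _ [z zu <-]; exact: fM.
Qed.

(* Riesz-Kantorovich: [dual_abs f] is the modulus of [f] on the positive cone. *)
Lemma dual_abs_cone_functional f : cone_functional (dual_abs f).
Proof.
have dZ (t : R) u : 0 < t -> 0 <= u -> dual_abs f (t *: u) <= t * dual_abs f u.
  move=> t0 u0; apply: dual_abs_le => [|z zu]; first by rewrite scalev_ge0 // ltW.
  rewrite -[z](scale1r z) -(divff (lt0r_neq0 t0)) -scalerA linearZ /= ler_pM2l //.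
  apply: dual_abs_ub => //; apply: (le_trans (vabsZ _ _)).
    by rewrite invr_ge0 ltW.
  rewrite -[u]scale1r -(mulVf (lt0r_neq0 t0)) -scalerA scalev_le //.
  by rewrite invr_ge0 ltW.
have d0 u : 0 <= u -> 0 <= dual_abs f u.
  by move=> u0; rewrite -(raddf0 f) dual_abs_ub // ge0_vabs.
split => //.
- move=> u v u0 v0; apply/eqP; rewrite eq_le; apply/andP; split.
    apply: dual_abs_le => [|z zuv]; first exact: addv_ge0.
    have [a [b [-> au bv]]] := riesz_decomposition u0 v0 zuv.
    by rewrite raddfD lerD // dual_abs_ub.
  rewrite -lerBrDr; apply: dual_abs_le => // a au.
  rewrite lerBrDr -lerBrDl; apply: dual_abs_le => // b bv.
  rewrite lerBrDl -raddfD dual_abs_ub ?addv_ge0 //.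
  by rewrite (le_trans (vabsD _ _)) // levD.
- move=> t u; rewrite le_eqVlt => /predU1P[<- u0|t0 u0].
    rewrite scale0r mul0r; apply/eqP; rewrite eq_le d0 // andbT.
    apply: dual_abs_le => // z; rewrite vabs_le oppr0 => /andP[z1 z2].
    by rewrite (_ : z = 0) ?raddf0 //; apply/eqP; rewrite eq_le z2 z1.
  apply/eqP; rewrite eq_le dZ //= -ler_pdivlMl //.
  have := @dZ t^-1 (t *: u); rewrite invr_gt0 scalerA mulVf ?gt_eqF // scale1r.
  by apply => //; rewrite scalev_ge0 // ltW.
- have [M fM] := dual_bounded f; exists `|M| => u u0.
  apply: dual_abs_le => // z zu.
  rewrite (le_trans (ler_norm _)) // (le_trans (fM z)) //.
  rewrite (le_trans (ler_wpM2r _ (ler_norm M))) // ler_wpM2l //.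
  exact: normv_le.
Qed.

Lemma cone_functional_sum_ord (n : nat) (h : nat -> E -> R) :
  (forall i, (i < n)%N -> cone_functional (h i)) ->
  cone_functional (fun u => \sum_(i < n) h i u).
Proof.
elim: n => [|n IH] hh.
  split => [u v _ _|u _|t u _ _|].
  - by rewrite !big_ord0 addr0.
  - by rewrite big_ord0.
  - by rewrite !big_ord0 mulr0.
  by exists 0 => u _; rewrite big_ord0 mul0r.
have [|D1 P1 Z1 [M1 H1]] := IH _; first by move=> i ni; apply: hh; exact: ltnW.
have [D2 P2 Z2 [M2 H2]] := hh n (ltnSn n).
split => [u v u0 v0|u u0|t u t0 u0|].
- by rewrite !big_ord_recr /= D1 // D2 // addrACA.
- by rewrite big_ord_recr /= addr_ge0 ?P1 ?P2.
- by rewrite !big_ord_recr /= Z1 // Z2 // mulrDr.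
by exists (M1 + M2) => u u0; rewrite big_ord_recr /= mulrDl lerD ?H1 ?H2.
Qed.

End absolute_value.

(** * Smallness on summable and on monotone sequences *)

Section order_bounded_summable.
Context {R : realType} {E : banachLatticeType R} {Y : completeNormedModType R}.
Variable T : {linear E -> Y}.
Implicit Types (u v w x z : E) (d b : nat -> E).

(* This implies that order bounded disjoint sequences are mapped to norm null
   sequences, the classical characterization of order weak compactness. *)
Definition null_on_summable := forall x d, (forall n, 0 <= d n) ->
  (forall n, \sum_(i < n) d i <= x) -> (fun n => `|T (d n)|) @ \oo --> (0 : R).

Definition small_on v (e : R) := forall z, vabs z <= v -> `|T z| <= e.

Hypothesis Tnull : null_on_summable.

(** Vectors [z n] violating the conclusion split into positive and negative parts, each below [d n]
    and so again with order bounded sums; both images under [T] tend to 0. *)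
Lemma summable_small x d (e : R) : (forall n, 0 <= d n) ->
  (forall n, \sum_(i < n) d i <= x) -> 0 < e -> exists n, small_on (d n) e.
Proof.
move=> d0 dx e0; apply: contrapT => /forallNP dn.
have /choice[z zP] n : exists z, vabs z <= d n /\ e < `|T z|.
  have /existsNP[z /not_implyP[zd /negP]] := dn n.
  by rewrite -ltNge => Tz; exists z.
have zd n : vabs (z n) <= d n by have [] := zP n.
have part (p : nat -> E) : (forall n, 0 <= p n) -> (forall n, p n <= d n) ->
    (fun n => `|T (p n)|) @ \oo --> (0 : R).
  move=> p0 pd; apply: (Tnull (x := x)) => // n.
  by apply: le_trans (dx n); apply: lev_sum => i.
have e20 : 0 < e / 2 by rewrite divr_gt0.
have /cvgrPdist_lt/(_ _ e20) P1 :
    (fun n => `|T (vpos (z n))|) @ \oo --> (0 : R).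
  by apply: part => n; [exact: vpos_ge0|have [] := vabs_vpos_bound (zd n)].
have /cvgrPdist_lt/(_ _ e20) P2 :
    (fun n => `|T (vpos (- z n))|) @ \oo --> (0 : R).
  by apply: part => n; [exact: vpos_ge0|have [] := vabs_vpos_bound (zd n)].
have [n [/= n1 n2]] := filter_ex (filterI P1 P2).
have [_] := zP n; rewrite -[z n]vposBN linearB ltNge => /negP; apply.
move: n1 n2; rewrite !sub0r !normrN !normr_id.
by have := ler_normB (T (vpos (z n))) (T (vpos (- z n))); lra.
Qed.

(** Otherwise, iterating a bad choice of the next index gives increments of [b] on none of which [T]
    is small, although their sums telescope and stay below [x]. *)
Lemma monotone_small_tail x b (e : R) : {homo b : m n / (m <= n)%N >-> m <= n} ->
  (forall n, 0 <= b n <= x) -> 0 < e ->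
  exists N, forall M, (N <= M)%N -> small_on (b M - b N) e.
Proof.
move=> bmon bx e0; apply: contrapT => /forallNP bN.
have /choice[phi phiP] N : exists M, (N <= M)%N /\ ~ small_on (b M - b N) e.
  by have /existsNP[M /not_implyP] := bN N; exists M.
pose s n := iter n phi 0%N.
have [n|n|n] := @summable_small x (fun n => b (s n.+1) - b (s n)) e _ _ e0.
- by rewrite subv_ge0 bmon //; have [] := phiP (s n).
- rewrite (_ : \sum_(i < n) _ = b (s n) - b (s 0%N)).
    rewrite (le_trans (subv_le _ _)) //.
      by have /andP[] := bx (s 0%N).
    by have /andP[] := bx (s n).
  elim: n => [|n IH]; first by rewrite big_ord0 subrr.
  by rewrite big_ord_recr /= IH addrC addrA subrK.
- by have [_] := phiP (s n).
Qed.

End order_bounded_summable.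

(** * Disjointification *)

Section AM_compactness.
Context {R : realType} {E : banachLatticeType R} {Y : completeNormedModType R}.
Implicit Types (u v w x z : E).

Fixpoint vjoins (u : nat -> E) (k n : nat) : E :=
  if n is n'.+1 then Order.join (vjoins u k n') (u (k + n')%N) else 0.

Lemma vjoins_bounds (u : nat -> E) x k n : (forall i, 0 <= u i <= x) ->
  0 <= vjoins u k n <= x.
Proof.
move=> ux; elim: n => [|n /andP[IH1 IH2]] /=.
  by rewrite lexx; have /andP[] := ux 0%N; exact: le_trans.
by rewrite leUx IH2 (le_trans IH1) ?leUl //=; have /andP[] := ux (k + n)%N.
Qed.

Lemma vjoins_homo (u : nat -> E) k :
  {homo vjoins u k : m n / (m <= n)%N >-> m <= n}.
Proof.
move=> m n; elim: n => [|n IH]; first by rewrite leqn0 => /eqP->.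
rewrite leq_eqVlt => /predU1P[->//|mn] /=.
by rewrite (le_trans (IH mn)) // leUl.
Qed.

Lemma le_vjoins (u : nat -> E) k n i : (k <= i < k + n)%N -> u i <= vjoins u k n.
Proof.
elim: n => [|n IH] /=; first by rewrite addn0 ltnNge => /andP[->].
rewrite addnS ltnS (leq_eqVlt i) => /andP[ki /predU1P[->|ikn]]; first exact: leUr.
by rewrite (le_trans (IH _)) ?leUl // ki.
Qed.

Lemma cone_functional_vjoins (h : E -> R) (u : nat -> E) k n :
  cone_functional h -> (forall i, 0 <= u i) ->
  h (vjoins u k n) <= \sum_(i < n) h (u (k + i)%N).
Proof.
move=> hh u0; have [hD h0 _ _] := hh.
have j0 m : 0 <= vjoins u k m.
  by elim: m => //= m IH; rewrite (le_trans IH) // leUl.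
elim: n => [|n IH]; first by rewrite big_ord0 /= cone_functional0.
rewrite big_ord_recr /= (le_trans _ (lerD IH (lexx _))) // -hD //.
apply: (cone_functional_le hh); first by rewrite (le_trans (j0 n)) // leUl.
by rewrite leUx addv_le //= -[leLHS]add0r levD2r.
Qed.

(* Disjointification: the decreasing sequence [w k = B 0 /\ ... /\ B k], where
   [B j] is a large finite join of the [u i] with [j <= i], still almost
   dominates [u k], while [h k] is small at [w k.+1]. Hence [h k] does not
   vanish on the increments of [w], which are summable below [x]. *)
Lemma summable_increments (T : {linear E -> Y}) (x : E) (u : nat -> E)
    (g : nat -> dual E) (e : R) : null_on_summable T ->
  (forall n, 0 <= u n <= x) -> (forall n z, `|g n z : R| <= `|T z|) -> 0 < e ->
  (forall n, e <= dual_abs (g n) (u n)) ->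
  (forall i n, (i < n)%N -> dual_abs (g i) (u n) <= e / 4 * (2 ^ n)%:R^-1) ->
  False.
Proof.
move=> Tnull ux gT e0 eg ge.
have u0 n : 0 <= u n by have /andP[] := ux n.
pose eps k := e / 8 * (2 ^ k)%:R^-1.
have eps0 k : 0 < eps k.
  by rewrite mulr_gt0 ?divr_gt0 // invr_gt0 ltr0n expn_gt0.
(* Beyond [N k] terms the join starting at [k] grows only by increments small for [T], hence small
   for every modulus [dual_abs (g n)]. *)
have /choice[N NP] k : exists N, forall M, (N <= M)%N ->
    small_on T (vjoins u k M - vjoins u k N) (eps k).
  apply: (monotone_small_tail Tnull (x := x)) => //; first exact: vjoins_homo.
  by move=> n; exact: vjoins_bounds.
pose B k := vjoins u k (N k).
pose w := fix w k := if k is k'.+1 then Order.meet (w k') (B k) else B 0%N.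
have B0 k : 0 <= B k by have /andP[] := vjoins_bounds k (N k) ux.
have w0 k : 0 <= w k by elim: k => [|k IH] /=; rewrite ?lexI ?IH B0.
have wS k : w k.+1 <= w k by rewrite /= leIl.
have small_abs n v r : 0 <= v -> small_on T v r -> dual_abs (g n) v <= r.
  move=> v0 vr; apply: dual_abs_le => // z zv.
  by rewrite (le_trans (ler_norm _)) // (le_trans (gT n z)) // vr.
have sumw n : \sum_(i < n) (w i - w i.+1) = w 0%N - w n.
  elim: n => [|n IH]; first by rewrite big_ord0 subrr.
  by rewrite big_ord_recr IH /= addrA subrK.
have [n|n||n dn] := summable_small Tnull (x := x) (d := fun n => w n - w n.+1)
  (e := e / 4).
- by rewrite subv_ge0.
- rewrite sumw (le_trans (subv_le _ (w0 n))) //.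
  by have /andP[] := vjoins_bounds 0%N (N 0%N) ux.
- by rewrite divr_gt0.
have hn := dual_abs_cone_functional (g n); have [hD h0 _ _] := hn.
have [M nM NM] : exists2 M, (n < M)%N & forall j, (j <= n)%N -> (N j <= M)%N.
  exists (n.+1 + \sum_(j < n.+1) N j)%N; first by rewrite leq_addr.
  by move=> j jn; rewrite (bigD1 (Ordinal (jn : (j < n.+1)%N))) //= addnCA leq_addr.
pose r j := vjoins u j M - B j.
have r0 j : (j <= n)%N -> 0 <= r j.
  by move=> jn; rewrite subv_ge0 vjoins_homo // NM.
have unB j : (j <= n)%N -> u n <= r j + B j.
  by move=> jn; rewrite subrK le_vjoins // jn (leq_trans nM) // leq_addl.
(* Each further meet with [B j] loses at most [r j]. *)
have unw j : (j <= n)%N -> u n <= w j + \sum_(i < j.+1) r i.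
  elim: j => [|j IH] jn; first by rewrite big_ord1 addrC unB.
  have sr0 : 0 <= \sum_(i < j.+1) r i.
    rewrite big_seq; elim/big_rec: _ => // i v _; apply: addv_ge0.
    by apply: r0; rewrite (leq_trans _ jn) // ltnW // ltn_ord.
  rewrite big_ord_recr /= -levBl lexI; apply/andP; split.
    rewrite levBl addrA (le_trans (IH (ltnW jn))) // addv_le //.
    exact: r0.
  rewrite levBl addrCA (le_trans (unB _ jn)) // (addrC (r _)).
  by rewrite -[leLHS]add0r levD2r.
have hr : dual_abs (g n) (\sum_(i < n.+1) r i) <= e / 4.
  rewrite cone_functional_sum //; last first.
    by move=> i _; apply: r0; rewrite -ltnS ltn_ord.
  apply: (@le_trans _ _ (\sum_(i < n.+1) eps i)).
    apply: ler_sum => i _; have lin : (i <= n)%N by rewrite -ltnS.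
    by apply: small_abs; [exact: r0|apply: NP; exact: NM].
  rewrite -mulr_sumr (_ : e / 4 = e / 8 * 2); last by field.
  by rewrite ler_wpM2l ?geometric_half_le // divr_ge0 // ltW.
have hw : e <= dual_abs (g n) (w n) + e / 4.
  rewrite (le_trans (eg n)) // (le_trans _ (lerD (lexx _) hr)) //.
  have sr0 : 0 <= \sum_(i < n.+1) r i.
    rewrite big_seq; elim/big_rec: _ => // i v _; apply: addv_ge0.
    by apply: r0; rewrite -ltnS ltn_ord.
  by rewrite -hD //; apply: (cone_functional_le hn) => //; exact: unw.
(* [w n.+1] lies below a join of [u i] with [i > n], where the modulus of [g n] is tiny; the
   resulting geometric series is at most [e / 4]. *)
have hw1 : dual_abs (g n) (w n.+1) <= e / 4.
  apply: (@le_trans _ _ (dual_abs (g n) (B n.+1))).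
    by apply: (cone_functional_le hn); [exact: w0|rewrite /= leIr].
  rewrite (le_trans (cone_functional_vjoins _ _ hn u0)) //.
  apply: (@le_trans _ _ (\sum_(i < N n.+1) e / 8 * (2 ^ i)%:R^-1)).
    apply: ler_sum => i _; rewrite (le_trans (ge _ _ _)) //.
      by rewrite addSn ltnS leq_addr.
    rewrite addSn expnS expnD !natrM !invfM.
    rewrite (_ : e / 4 * _ = e / 8 * (2 ^ i)%:R^-1 * (2 ^ n)%:R^-1); last by field;
      rewrite !pnatr_eq0 -!lt0n !expn_gt0.
    rewrite ler_piMr // ?mulr_ge0 ?divr_ge0 ?invr_ge0 ?ler0n ?(ltW e0) //.
    by rewrite invf_le1 ?ltr0n ?expn_gt0 // ler1n expn_gt0.
  rewrite -mulr_sumr (_ : e / 4 = e / 8 * 2); last by field.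
  by rewrite ler_wpM2l ?geometric_half_le // divr_ge0 // ltW.
(* The modulus of [g n] is at least [3 e / 4] at [w n], yet the increment and [w n.+1] contribute at
   most [e / 4] each. *)
have := small_abs n _ _ _ dn; rewrite subv_ge0 wS => /(_ isT).
have := hD (w n - w n.+1) (w n.+1); rewrite subv_ge0 wS w0 subrK => /(_ isT isT).
by move: hw hw1; lra.
Qed.

End AM_compactness.

(** If images stay [e] apart, total boundedness for the sum of the moduli chosen so far yields
    [v = vabs (y m1 - y m2)] on which all of them are tiny, while a norming functional of
    [T (y m1 - y m2)], pulled back, has modulus at least [e] at [v]. Such a sequence contradicts
    [summable_increments]. *)
Lemma null_on_summable_AM_compact (R : realType) (E : banachLatticeType R)
    (Y : completeNormedModType R) (T : {linear E -> Y}) :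
  (forall a b : E, limited `[a, b]) -> bounded_operator T ->
  null_on_summable T -> AM_compact T.
Proof.
move=> limE bT Tnull x x0; apply: separated_precompact => e t e0 tA.
have /choice[y yP] n : exists y, vabs y <= x /\ T y = t n.
  have [y + <-] := tA n; rewrite /= in_itv /= => yx.
  by exists y; rewrite vabs_le.
have yx n : vabs (y n) <= x by have [] := yP n.
apply: contrapT => /forallNP sep.
have {}sep m n : (m < n)%N -> e <= `|T (y m - y n)|.
  move=> mn; rewrite linearB leNgt; apply/negP => lt.
  by apply: (sep m); exists n; have [_ <-] := yP m; have [_ <-] := yP n.
have X0 : 0 <= x + x by exact: addv_ge0.
have [|ug [ugQ ugS]] := @greedy_sequence (E * dual E) (0, 0)
  (fun p => [/\ 0 <= p.1 <= x + x, e <= dual_abs p.2 p.1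
    & forall z, `|p.2 z : R| <= `|T z|])
  (fun n p q => dual_abs p.2 q.1 <= e / 4 * (2 ^ n)%:R^-1).
  move=> n u uQ.
  have en0 : 0 < e / 4 * (2 ^ n)%:R^-1.
    by rewrite mulr_gt0 ?divr_gt0 // invr_gt0 ltr0n expn_gt0.
  have hh := cone_functional_sum_ord (n := n)
    (fun i _ => dual_abs_cone_functional (u i).2).
  have [m1 [m2 [m12 hlt]]] :=
    limited_intervals_total_boundedness limE hh x0 yx en0.
  pose v := vabs (y m1 - y m2).
  have v0 : 0 <= v by exact: vabs_ge0.
  have [f [f1 fv]] := norming_functional (T (y m1 - y m2)).
  have [g gf] := dual_comp bT f1.
  exists (v, g); split => /=.
    split => [||z]; last by rewrite gf.
      by rewrite v0 (le_trans (vabsD _ _)) // vabsN levD.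
    by rewrite (le_trans (sep _ _ m12)) // -fv -gf dual_abs_ub.
  move=> i ni; apply: le_trans (ltW hlt); rewrite (bigD1 (Ordinal ni)) //= lerDl.
  by apply: sumr_ge0 => j _; have [_ h0 _ _] := dual_abs_cone_functional (u j).2; exact: h0.
apply: (summable_increments (x := x + x) (u := fun n => (ug n).1)
  (g := fun n => (ug n).2) Tnull _ _ e0) => [n|n|n|//].
- by have [] := ugQ n.
- by have [] := ugQ n.
- by have [] := ugQ n.
Qed.

(** * Operators that are null on order bounded summable sequences *)

(* Split the indices into infinitely many infinite blocks: if
   no block works, each block contains a row with more than [e] of its mass
   inside the block, so the rows thus selected have mass at most [C - e] on the
   selected columns. *)
Lemma rosenthal (R : realType) (a : nat -> nat -> R) (C e : R) : 0 < e ->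
  (forall i j, 0 <= a i j) ->
  (forall i s, uniq s -> \sum_(j <- s) a i j <= C) ->
  exists phi : nat -> nat, injective phi /\
    forall i s, uniq s -> i \notin s -> \sum_(j <- s) a (phi i) (phi j) <= e.
Proof.
move=> e0; have [m] : exists m : nat, C <= m%:R * e.
  exists (Num.truncn (C / e)).+1; rewrite -ler_pdivrMr //.
  exact/ltW/truncnS_gt.
elim: m C a => [|m IH] C a Cm a0 aC.
  exists id; split => // i s us _; rewrite (le_trans (aC i s us)) //.
  by rewrite (le_trans Cm) // mul0r ltW.
pose psi (p j : nat) : nat := pickle (p, j).
have psi_inj p q i j : psi p i = psi q j -> (p, i) = (q, j).
  exact: (pcan_inj pickleK).
have [[p pe]|nop] := pselect (exists p, forall i s, uniq s -> i \notin s ->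
    \sum_(j <- s) a (psi p i) (psi p j) <= e).
  by exists (psi p); split => // i j /psi_inj[].
have /choice[it itP] p : exists it : nat * seq nat, [/\ uniq it.2, it.1 \notin it.2
    & e < \sum_(j <- it.2) a (psi p it.1) (psi p j)].
  move/forallNP: nop => /(_ p)/existsNP[i /existsNP[s /not_implyP[us]]].
  by move=> /not_implyP[nis /negP]; rewrite -ltNge => lt; exists (i, s).
pose chi p := psi p (it p).1.
have chi_inj : injective chi by move=> p q /psi_inj[].
have [||phi [phi_inj phiP]] := IH (m%:R * e) (fun p q => a (chi p) (chi q)) (lexx _).
- by move=> i j; exact: a0.
(* The columns that witness failure inside block [p] avoid all selected columns, so they take more
   than [e] from the mass of row [chi p]. *)
- move=> p s us; have [ut nit lt] := itP p.
  have /(aC (chi p)) : uniq (map chi s ++ map (psi p) (it p).2).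
    rewrite cat_uniq !map_inj_uniq ?us ?ut //; last by move=> i j /psi_inj[].
    rewrite andbT /=; apply/hasPn => _ /mapP[j js ->]; apply/mapP => -[q _].
    by move=> /psi_inj[pq]; move: js; rewrite pq => + je; rewrite je -pq (negbTE nit).
  rewrite big_cat !big_map /= => le; move: Cm; rewrite -natr1 mulrDl mul1r => Cm.
  by move: lt le Cm; lra.
exists (chi \o phi); split; first exact: inj_comp.
exact: phiP.
Qed.

Section null_on_summable_criteria.
Context {R : realType} {E : banachLatticeType R}.

Lemma summable_uniq_sum (x : E) (d : nat -> E) : (forall n, 0 <= d n) ->
  (forall n, \sum_(i < n) d i <= x) -> forall s, uniq s -> \sum_(i <- s) d i <= x.
Proof.
move=> d0 dx s us; pose N := (\max_(i <- s) i).+1.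
have sN i : i \in s -> (i < N)%N.
  by move=> js; rewrite ltnS; exact: leq_bigmax_seq.
have := dx N; rewrite -(big_mkord xpredT d) /index_iota subn0.
rewrite (@perm_big _ _ _ _ _ (s ++ [seq i <- iota 0 N | i \notin s])); last first.
  apply: uniq_perm; first exact: iota_uniq.
    rewrite cat_uniq us filter_uniq ?iota_uniq // andbT.
    by apply/hasPn => i; rewrite mem_filter => /andP[].
  move=> i; rewrite mem_cat mem_filter mem_iota add0n /=.
  by have [/sN ->|] := boolP (i \in s).
by rewrite big_cat; apply: le_trans; rewrite addv_le // sumv_ge0.
Qed.

Lemma uniq_sum_inj (x : E) (d : nat -> E) (phi : nat -> nat) : injective phi ->
  (forall s, uniq s -> \sum_(i <- s) d i <= x) ->
  forall s, uniq s -> \sum_(i <- s) d (phi i) <= x.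
Proof. by move=> inj dx s us; rewrite -(big_map phi xpredT) dx // map_inj_uniq. Qed.

Lemma dual_abs_summable (x : E) (d : nat -> E) (g : dual E) (s : seq nat) :
  (forall n, 0 <= d n) -> \sum_(i <- s) d i <= x ->
  \sum_(i <- s) `|g (d i) : R| <= dual_abs g x.
Proof.
move=> d0 dx; have hg := dual_abs_cone_functional g.
have s0 : 0 <= \sum_(i <- s) d i by exact: sumv_ge0.
apply: le_trans (cone_functional_le hg s0 dx).
rewrite cone_functional_sum //; apply: ler_sum => i _; rewrite ler_norml.
rewrite lerNl -raddfN !dual_abs_ub ?vabsN //; by rewrite ge0_vabs.
Qed.

Variables (Y : completeNormedModType R) (T : {linear E -> Y}).
Hypothesis bT : bounded_operator T.

(** When [f] is pulled back along [T], the sum is at most the modulus of the pullback at [x]; the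
    constant depends on [T] and [x] alone. *)
Lemma summable_functional_bound (x : E) : exists2 C : R, 0 <= C &
  forall (f : dual Y) (d : nat -> E) (s : seq nat),
  (forall z, `|f z : R| <= `|z|) -> (forall n, 0 <= d n) ->
  \sum_(i <- s) d i <= x -> \sum_(i <- s) `|f (T (d i)) : R| <= C.
Proof.
have [M TM] := bT; exists (`|M| * `|x|); first exact: mulr_ge0.
move=> f d s f1 d0 dx; have [g gf] := dual_comp bT f1.
have x0 : 0 <= x by apply: le_trans dx; exact: sumv_ge0.
under eq_bigr do rewrite -gf.
rewrite (le_trans (dual_abs_summable g d0 dx)) //; apply: dual_abs_le => // z zx.
rewrite gf (le_trans (ler_norm _)) // (le_trans (f1 _)) // (le_trans (TM _)) //.
rewrite (le_trans (ler_wpM2r _ (ler_norm M))) // ler_wpM2l //.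
exact: normv_le.
Qed.

(** Along a subsequence with [|T d_n| >= e], take norming functionals [f_n]. The rows of
    [|f_i (T d_j)|] have bounded mass, so Rosenthal's lemma makes the off-diagonal mass at most
    [e / 4]. *)
Lemma not_null_biorthogonal (x : E) (d : nat -> E) : (forall n, 0 <= d n) ->
  (forall n, \sum_(i < n) d i <= x) ->
  ~ (fun n => `|T (d n)|) @ \oo --> (0 : R) ->
  exists (e : R) (c : nat -> E) (f : nat -> dual Y),
  [/\ 0 < e, forall n, 0 <= c n, forall s, uniq s -> \sum_(i <- s) c i <= x
    & [/\ forall i z, `|f i z : R| <= `|z|, forall i, e <= f i (T (c i))
    & forall i s, uniq s -> i \notin s ->
        \sum_(j <- s) `|f i (T (c j)) : R| <= e / 4]].
Proof.
move=> d0 dx nT; have dus := summable_uniq_sum d0 dx.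
have [e e0 eT] : exists2 e : R, 0 < e & forall N, exists2 n, (N <= n)%N & e <= `|T (d n)|.
  apply: contrapT => noe; apply: nT; apply/cvgrPdist_lt => e e0.
  apply: contrapT => nN; apply: noe; exists e => // N; apply: contrapT => nn.
  apply: nN; exists N => // n /= Nn; rewrite sub0r normrN normr_id ltNge.
  by apply/negP => en; apply: nn; exists n.
have [n u _|sg [sgQ sgS]] := @greedy_sequence nat 0%N (fun n => e <= `|T (d n)|)
    (fun _ i j => (i < j)%N).
  have [m Nm em] := eT (\max_(i < n) u i).+1; exists m; split => // i ni.
  by apply: leq_trans Nm; rewrite ltnS (bigD1 (Ordinal ni)) //= leq_maxl.
have sg_inj : injective sg.
  by move=> i j eqij; case: (ltngtP i j) => // /sgS; rewrite eqij ltnn.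
have /choice[f fP] n := norming_functional (T (d (sg n))).
have [C C0 Cb] := summable_functional_bound x.
have e40 : 0 < e / 4 by rewrite divr_gt0.
have [||phi [phi_inj phiP]] := @rosenthal R (fun i j => `|f i (T (d (sg j))) : R|)
  C (e / 4) e40.
- by [].
- move=> i s us; apply: (Cb _ (d \o sg)) => //.
  + by have [] := fP i.
  + by move=> n; exact: d0.
  exact: (uniq_sum_inj sg_inj dus us).
exists e, (d \o sg \o phi), (f \o phi); split => // [n|s us|].
- exact: d0.
- exact: (uniq_sum_inj phi_inj (uniq_sum_inj sg_inj dus) us).
split => [i z|i|i s us nis].
- by have [] := fP (phi i).
- by have [_ ->] := fP (phi i); exact: sgQ.
- exact: phiP.
Qed.

End null_on_summable_criteria.

(** * Order continuous norms *)

(** The gaps [z - s n] between upper bounds and terms are directed downwards. A lower bound [w] of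
    the gaps can be subtracted from [c] repeatedly without leaving the upper bounds, so
    [k *: w <= c - s 0] for all [k], and the Archimedean property gives [w <= 0]. *)
Lemma order_continuous_norm_gap (R : realType) (F : banachLatticeType R)
    (s : nat -> F) (c : F) (e : R) : order_continuous_norm F ->
  {homo s : m n / (m <= n)%N >-> m <= n} -> (forall n, s n <= c) -> 0 < e ->
  exists z n, (forall m, s m <= z) /\ `|z - s n| < e.
Proof.
move=> ocF smon sc e0.
pose ub z := forall m, s m <= z.
pose D := [set y | exists z n, ub z /\ y = z - s n].
have D0 : D !=set0 by exists (c - s 0%N), c, 0%N.
have : inf [set `|y| | y in D] = 0.
  apply: ocF => //.
    move=> _ _ [z [m [uz ->]]] [w [n [uw ->]]].
    exists (Order.meet z w - s (maxn m n)).
      by exists (Order.meet z w), (maxn m n); split => // k; rewrite lexI uz uw.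
    have leB (a b : F) k l : a <= b -> (l <= k)%N -> a - s k <= b - s l.
      by move=> ab lk; rewrite levD ?levN ?smon.
    split; first exact: leB (leIl _ _) (leq_maxl _ _).
    exact: leB (leIr _ _) (leq_maxr _ _).
  split=> [_ [z [n [uz ->]]]|w wD]; first by rewrite subv_ge0.
  have ubk k : ub (c - k%:R *: w).
    elim: k => [|k IH] m; first by rewrite scale0r subr0.
    have /wD : D ((c - k%:R *: w) - s m) by exists (c - k%:R *: w), m.
    rewrite levBr => ws.
    by rewrite -natr1 scalerDl scale1r opprD addrA levBr (addrC (s m)).
  apply: (@archimedean_le0 _ _ _ (c - s 0%N)) => k.
  by rewrite levBr addrC -levBr; exact: ubk.
move=> infD; have [|_ [_ [z [n [uz ->]]] <-] le] :=
  @inf_adherent R [set `|y| | y in D] e e0.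
  by split; [have [y Dy] := D0; exists `|y|, y|exists 0 => _ [y _ <-]].
by exists z, n; split => //; rewrite infD add0r in le.
Qed.

(** By positivity the sums of the [T (d i)] increase below [T x]. Once an upper bound [z] is
    [e]-close to [s N], each later [T (d n)] lies between 0 and [z - s N]. *)
Lemma order_continuous_null (R : realType) (E F : banachLatticeType R)
    (T : {linear E -> F}) : order_continuous_norm F -> positive_operator T ->
  null_on_summable T.
Proof.
move=> ocF posT x d d0 dx; apply/cvgrPdist_lt => e e0.
have Tle u v : u <= v -> T u <= T v.
  by move=> uv; rewrite -subv_ge0 -linearB posT // subv_ge0.
pose s n := T (\sum_(i < n) d i).
have smon : {homo s : m n / (m <= n)%N >-> m <= n}.
  move=> m n /subnK <-; apply: Tle; elim: (n - m)%N => // k IH.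
  by rewrite addSn big_ord_recr (le_trans IH) // addv_le.
have [z [N [uz zN]]] := order_continuous_norm_gap (c := T x) ocF smon
  (fun n => Tle _ _ (dx n)) e0.
exists N => // n /= Nn; rewrite sub0r normrN normr_id; apply: le_lt_trans zN.
have -> : T (d n) = s n.+1 - s n by rewrite /s big_ord_recr linearD addrC addKr.
apply: normv_ge0_le; first by rewrite subv_ge0 smon.
by rewrite levD ?levN ?smon.
Qed.

(** * Weak compactness *)

Section weak_compactness.
Context {R : realType} {Y : completeNormedModType R}.

Lemma weak_nbhs (f : dual Y) (z : weak Y) (e : R) : 0 < e ->
  nbhs z [set w : weak Y | `|(f w : R) - f z| < e].
Proof.
move=> e0; have [+ _] := @cvg_sup Y (dual Y)
  (fun f : dual Y => Topological.class (initial_topology f)) (nbhs z) z _.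
move=> /(_ cvg_id) /(_ f) nbhs_f; apply: (nbhs_f [set w | `|(f w : R) - f z| < e]).
apply: (@initial_continuous Y R^o f z [set r | `|r - f z| < e]).
by exists e => // r; rewrite /= distrC.
Qed.

Lemma weak_ultra_limit (A : set Y) (T : Type) (U : set_system T) (s : T -> Y) :
  relatively_weakly_compact A -> UltraFilter U -> (forall t, A (s t)) ->
  exists z : Y, forall (f : dual Y) (e : R), 0 < e ->
    U [set t | `|(f (s t) : R) - f z| < e].
Proof.
move=> [K AK [cK _]] UU sA.
have [|z [_ cl]] := cK ((s : T -> weak Y) @ U) _.
  by apply: (@filterE _ U) => t /=; exact: AK.
exists z => f e e0.
have [//|Uc] := in_ultra_setVsetC [set t | `|(f (s t) : R) - f z| < e] UU.
have [] := cl [set w : weak Y | ~ `|(f w : R) - f z| < e]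
  [set w : weak Y | `|(f w : R) - f z| < e].
- exact: Uc.
- exact: weak_nbhs.
- by move=> w [].
Qed.

(* Distance to the linear span of the sequence [y]. *)
Lemma span_distance (y : nat -> Y) : exists q : Y -> R,
  [/\ sublinear q, forall z, q (- z) = q z, forall z, q z <= `|z|,
    forall k, q (y k) <= 0
  & forall z e, q z < e -> exists (K : nat) (c : nat -> R),
    (forall k, (K <= k)%N -> c k = 0) /\ `|z - \sum_(k < K) c k *: y k| < e].
Proof.
pose D := [set w | exists (K : nat) (c : nat -> R),
    (forall k, (K <= k)%N -> c k = 0) /\ w = \sum_(k < K) c k *: y k].
have widen K c N : (forall k, (K <= k)%N -> c k = 0) -> (K <= N)%N ->
    \sum_(k < K) c k *: y k = \sum_(k < N) c k *: y k.
  move=> c0 KN; rewrite -!(big_mkord xpredT (fun k => c k *: y k)).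
  rewrite (big_cat_nat (leq0n K) KN) //= [X in _ = _ + X]big_nat.
  rewrite [X in _ = _ + X]big1 ?addr0 // => k /andP[Kk _].
  by rewrite c0 // scale0r.
have DD u v : D u -> D v -> D (u + v).
  move=> [K [c [c0 ->]]] [L [d [d0 ->]]].
  exists (maxn K L), (fun k => c k + d k); split.
    by move=> k; rewrite geq_max => /andP[Kk Lk]; rewrite c0 // d0 // addr0.
  rewrite (widen K c (maxn K L)) ?leq_maxl // (widen L d (maxn K L)) ?leq_maxr //.
  by rewrite -big_split; apply: eq_bigr => k _; rewrite scalerDl.
have DZ (t : R) u : D u -> D (t *: u).
  move=> [K [c [c0 ->]]]; exists K, (fun k => t * c k); split.
    by move=> k /c0 ->; rewrite mulr0.
  by rewrite scaler_sumr; apply: eq_bigr => k _; rewrite scalerA.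
have D0 : D 0 by exists 0%N, (fun=> 0); rewrite big_ord0.
have Dy k : D (y k).
  exists k.+1, (fun j => (j == k)%:R); split.
    by move=> j; case: eqP => // ->; rewrite ltnn.
  rewrite big_ord_recr /= eqxx scale1r big1 ?add0r // => j _.
  by rewrite lt_eqF ?scale0r // ltEnat /= ltn_ord.
have [|||||q [sq qle qge]] := @sublinear_inf R Y Y D (fun w z => `|z - w|) (fun=> 0).
- by exists 0.
- by [].
- by [].
- move=> u v z w Du Dv; exists (u + v); first exact: DD.
  by rewrite opprD addrACA ler_normD.
- move=> u t z Du t0; exists (t *: u); first exact: DZ.
  by rewrite -scalerBr normrZ gtr0_norm.
have qN z : q (- z) <= q z.
  apply: qge => w Dw; have DN : D (- w) by rewrite -scaleN1r; exact: DZ.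
  by have := qle _ (- z) DN; rewrite -opprD normrN.
exists q; split => //.
- by move=> z; apply/eqP; rewrite eq_le qN -[X in q X <= _]opprK qN.
- by move=> z; have := qle 0 z D0; rewrite subr0.
- by move=> k; have := qle (y k) (y k) (Dy k); rewrite subrr normr0.
- move=> z e qe; apply: contrapT => nK.
  suff : e <= q z by rewrite leNgt qe.
  apply: qge => w [K [c [c0 ->]]]; rewrite leNgt; apply/negP => lt.
  by apply: nK; exists K, c.
Qed.

End weak_compactness.

(* A biorthogonal subsequence spans a copy of the unit vector basis of [c0] whose
   partial sums have a weak limit [z]. By Hahn-Banach [z] is close to a finite
   combination of the sequence, which the biorthogonal functionals contradict. *)
Lemma weakly_compact_null (R : realType) (E : banachLatticeType R)
    (Y : completeNormedModType R) (T : {linear E -> Y}) : bounded_operator T ->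
  (forall x, 0 <= x -> exists (t : R) (A : set Y), [/\ 0 < t,
     relatively_weakly_compact A & forall z, 0 <= z -> z <= x -> A (t *: T z)]) ->
  null_on_summable T.
Proof.
move=> bT wT x d d0 dx; apply: contrapT => nT.
have x0 : 0 <= x by have := dx 0%N; rewrite big_ord0.
have [e [c [f [e0 c0 cx [f1 fe fo]]]]] := not_null_biorthogonal bT d0 dx nT.
have [t [A [t0 wA TA]]] := wT x x0.
pose y k := T (c k); pose s n := \sum_(k < n) y k.
have [U [UU Uoo]] := @ultraFilterLemma nat \oo _.
have [n|z zP] := weak_ultra_limit (s := fun n => t *: s n) wA UU.
  rewrite /s /y -linear_sum; apply: TA; first exact: sumv_ge0.
  by rewrite -(big_mkord xpredT c) cx // iota_uniq.
have {}zP (g : dual Y) r : 0 < r -> U [set n | `|(g (s n) : R) - g (t^-1 *: z)| < r].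
  move=> r0; have tr0 : 0 < t * r by exact: mulr_gt0.
  apply: filterS (zP g _ tr0) => n /=.
  have -> : (g (t *: s n) : R) - g z = t * (g (s n) - g (t^-1 *: z)).
    have -> : (g (t *: s n) : R) = t * g (s n) by rewrite linearZ.
    have -> : (g (t^-1 *: z) : R) = t^-1 * g z by rewrite linearZ.
    by field; rewrite gt_eqF.
  by rewrite normrM gtr0_norm // ltr_pM2l.
set w := t^-1 *: z in zP.
have [q [sq qN qle qy qe]] := span_distance y.
(* [g] vanishes on the span of [y], so it is small at the weak limit [w]; hence [w] is within
   [e / 4] of the span. *)
have [g [gq gw]] := seminorm_functional w sq qN qle.
have gy k : (g (y k) : R) = 0.
  by apply/eqP; rewrite -normr_le0 (le_trans (gq _)).
have gs n : (g (s n) : R) = 0.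
  by rewrite /s raddf_sum big1 // => k _; exact: gy.
have e40 : 0 < e / 4 by rewrite divr_gt0.
have qw : q w < e / 4.
  have [n /=] := filter_ex (zP g _ e40); rewrite gs sub0r normrN -gw.
  exact: le_lt_trans (ler_norm _).
have [K [a [a0 aw]]] := qe _ _ qw; set v := \sum_(k < K) _ in aw.
(* The coefficients of [s n - v]. They equal 1 from [K] on, so [|b k|] attains its maximum at some
   [i <= K], and that maximum is at least 1. *)
pose b k := 1 - a k.
have bK k : (K <= k)%N -> b k = 1 by move=> Kk; rewrite /b a0 // subr0.
have [i [iK bi]] : exists i, (i < K.+1)%N /\ forall k, `|b k| <= `|b i|.
  have [i _ iP] := @arg_maxP _ _ _ (ord0 : 'I_K.+1) xpredT (fun k => `|b k|) isT.
  exists i; split => // k; have [kK|Kk] := ltnP k K.+1; first exact: (iP (Ordinal kK)).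
  by have := iP ord_max isT; rewrite /= (bK K) // (bK k) // ltnW.
have b1 : 1 <= `|b i| by have := bi K; rewrite bK // normr1.
have [n [/= nfi nK]] := filter_ex (filterI (zP (f i) _ e40) (Uoo _ (nbhs_infty_ge K.+1))).
have vE : v = \sum_(k < n) a k *: y k.
  rewrite /v -!(big_mkord xpredT (fun k => a k *: y k)).
  rewrite (big_cat_nat (leq0n K) (ltnW nK)) //= [X in _ = _ + X]big_nat.
  rewrite [X in _ = _ + X]big1 ?addr0 // => k /andP[Kk _].
  by rewrite a0 // scale0r.
have svE : s n - v = \sum_(k < n) b k *: y k.
  by rewrite vE /s -sumrB; apply: eq_bigr => k _; rewrite scalerBl scale1r.
have iN : (i < n)%N by exact: leq_trans nK.
(* Maximality of [|b i|] bounds the other terms by [|b i| * (e / 4)] in total, so [f i] is at least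
   [3 e / 4] in modulus at [s n - v], whereas closeness to [w] makes it less than [e / 2]. *)
have : `|b i| * e <= `|f i (s n - v) : R| + `|b i| * (e / 4).
  rewrite svE raddf_sum (bigD1 (Ordinal iN)) //=.
  set S := \sum_(k < n | _) _.
  have Sle : `|S : R| <= `|b i| * (e / 4).
    rewrite (le_trans (ler_norm_sum _ _ _)) //.
    apply: (@le_trans _ _ (\sum_(k < n | k != Ordinal iN) `|b i| * `|f i (y k) : R|)).
      apply: ler_sum => k _; rewrite linearZ /= normrM ler_wpM2r //.
    rewrite -mulr_sumr ler_wpM2l //.
    have -> : \sum_(k < n | k != Ordinal iN) `|f i (y k) : R| =
        \sum_(k <- [seq k <- iota 0 n | k != i]) `|f i (y k) : R|.
      have := big_mkord (fun k => k != i) (fun k => `|f i (y k) : R|) (n := n).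
      rewrite big_filter /index_iota subn0 => ->.
      by apply: eq_bigl => k.
    by rewrite fo ?filter_uniq ?iota_uniq // mem_filter eqxx.
  have : `|b i| * e <= `|f i (b i *: y i) : R|.
    by rewrite linearZ /= normrM ler_wpM2l // (le_trans (fe i)) // ler_norm.
  have := ler_normB ((f i (b i *: y i) : R) + S) S.
  by rewrite addrK; move: Sle; lra.
have : `|f i (s n - v) : R| < e / 2.
  have -> : (f i (s n - v) : R) = (f i (s n) - f i w) + f i (w - v).
    by rewrite !raddfB /= addrA subrK.
  rewrite (le_lt_trans (ler_normD _ _)) // (_ : e / 2 = e / 4 + e / 4); last by field.
  by rewrite ltrD // (le_lt_trans (f1 _ _)).
have : e / 4 * 3 <= `|b i| * (e / 4 * 3) by rewrite ler_peMl // mulr_ge0 // ltW.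
by move: e0; lra.
Qed.

(** * Embedding [c0] *)

Section c0_embedding.
Context {R : realType}.

Lemma c0_of_seq (a : nat -> R) : a @ \oo --> (0 : R) -> exists u : c0 R, forall n, u n = a n.
Proof.
move=> a0; have c0a : (a : nat -> R^o) \in @c0_pred R by apply/asboolP.
by exists (C0 c0a).
Qed.

Lemma c0_cvg (u : c0 R) : (fun n => u n : R) @ \oo --> (0 : R).
Proof. by have /asboolP := c0_seqP u. Qed.

Context {Y : completeNormedModType R}.
Variables (y : nat -> Y) (C e : R).
Hypotheses (C0 : 0 <= C) (e0 : 0 < e).
Hypothesis y_upper : forall (a : nat -> R) (m n : nat) (M : R), 0 <= M ->
  (forall k, (m <= k < n)%N -> `|a k| <= M) ->
  `|\sum_(m <= k < n) a k *: y k| <= C * M.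
Hypothesis y_lower : forall (a : nat -> R) (M : R) (n i : nat),
  (forall k, `|a k| <= M) -> (i < n)%N ->
  e * `|a i| <= `|\sum_(0 <= k < n) a k *: y k| + M * (e / 4).

Let term (u : c0 R) (k : nat) : Y := (u k : R) *: y k.

Lemma c0_series_cvg (u : c0 R) : cvgn (series (term u)).
Proof.
apply: cauchy_cvg; apply/cauchy_seriesP => r r0.
have rC0 : 0 < r / (C + 1) by rewrite divr_gt0 // ltr_wpDl.
have /cvgrPdist_lt/(_ _ rC0)[N _ NP] := c0_cvg u.
exists ([set n | (N <= n)%N], [set n | (N <= n)%N]) => /=; first by split; exists N.
move=> [m n] /= [Nm _].
apply: (@le_lt_trans _ _ (C * (r / (C + 1)))).
  apply: y_upper => [|k /andP[mk _]]; first exact: ltW.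
  by have := NP k (leq_trans Nm mk); rewrite /= sub0r normrN => /ltW.
by rewrite mulrA ltr_pdivrMr ?ltr_wpDl // mulrC ltr_pM2l // ltrDl.
Qed.

Definition c0_embed (u : c0 R) : Y := limn (series (term u)).

Lemma c0_embed_cvg (u : c0 R) : series (term u) @ \oo --> c0_embed u.
Proof. exact: c0_series_cvg. Qed.

Lemma c0_embed_norm (u : c0 R) :
  (fun n => `|series (term u) n|) @ \oo --> `|c0_embed u|.
Proof. by apply: cvg_norm; exact: c0_embed_cvg. Qed.

Lemma c0_embed_linear : linear c0_embed.
Proof.
move=> a u v; apply: cvg_lim => //.
have -> : series (term (a *: u + v)) =
    (fun n => a *: series (term u) n + series (term v) n).
  apply/funext => n /=; rewrite /series /= scaler_sumr -big_split /=.
  apply: eq_bigr => k _; rewrite /term scalerA -scalerDl.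
  by congr (_ *: _).
apply: cvgD; last exact: c0_embed_cvg.
by apply: cvgZr; exact: c0_embed_cvg.
Qed.

Lemma c0_embed_le (u : c0 R) : `|c0_embed u| <= C * `|u|.
Proof.
rewrite -(cvg_lim _ (@c0_embed_norm u)) //.
apply: limr_le; first exact: cvgP (@c0_embed_norm u).
by apply: nearW => n; apply: y_upper => // k _; exact: c0_norm_ub.
Qed.

(** Letting [n] tend to infinity in [y_lower] and taking the supremum over [i] gives the constant
    [3 e / 4], of which [e / 2] is kept. *)
Lemma c0_embed_ge (u : c0 R) : e / 2 * `|u| <= `|c0_embed u|.
Proof.
have ui i : e * `|u i : R| <= `|c0_embed u| + `|u| * (e / 4).
  rewrite -lerBlDr.
  rewrite -(cvg_lim _ (@c0_embed_norm u)) //.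
  apply: limr_ge; first exact: cvgP (@c0_embed_norm u).
  exists i.+1 => // n /= ni; rewrite lerBlDr.
  exact: (y_lower (fun k => c0_norm_ub u k) ni).
have : `|u| <= (`|c0_embed u| + `|u| * (e / 4)) / e.
  by apply: c0_norm_le => i; rewrite ler_pdivlMr // mulrC.
rewrite ler_pdivlMr //; have : 0 <= `|u| * e by rewrite mulr_ge0 // ltW.
lra.
Qed.

Lemma c0_embedB (u v : c0 R) : c0_embed (u - v) = c0_embed u - c0_embed v.
Proof.
by rewrite addrC -[- v]scaleN1r c0_embed_linear scaleN1r addrC.
Qed.

(** Preimages [u n] of approximations to [p] are Cauchy by the lower estimate. Their limit is formed
    coordinatewise along an ultrafilter; the error bound is uniform in the coordinate, so the limit
    is again a null sequence. *)
Lemma c0_embed_closed : closed (range c0_embed).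
Proof.
apply/closure_id/seteqP; split; first exact: subset_closure.
move=> p clp; pose D n : R := n.+1%:R^-1; pose K := e / 2.
have D0 n : 0 < D n by rewrite invr_gt0.
have K0 : 0 < K by rewrite divr_gt0.
have /choice[u uP] n : exists u, `|c0_embed u - p| < D n.
  have [_ [[u _ <-] up]] := clp _ (nbhsx_ballx p _ (D0 n)).
  by exists u; move: up; rewrite -ball_normE /= distrC.
have Dle m n : (m <= n)%N -> D n <= D m.
  by move=> mn; rewrite lef_pV2 ?posrE ?ltr0n // ler_nat.
have uu m n : (m <= n)%N -> `|u m - u n| <= 2 * D m / K.
  move=> mn; rewrite ler_pdivlMr // mulrC (le_trans (c0_embed_ge _)) // c0_embedB.
  have := ler_distD p (c0_embed (u m)) (c0_embed (u n)).
  by have := uP m; have := uP n; rewrite (distrC p); have := Dle _ _ mn; lra.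
have [U [UU Uoo]] := @ultraFilterLemma nat \oo _.
have /choice[a aP] k : exists l : R, forall r, 0 < r ->
    U [set n | `|(u n k : R) - l| < r].
  apply: (@ultra_bounded_cvg _ _ _ _ (`|u 0%N| + 2 * D 0%N / K)) => n.
  rewrite (le_trans (c0_norm_ub _ _)) //.
  have := ler_normB (u 0%N) (u 0%N - u n); rewrite subKr => /le_trans; apply.
  by rewrite lerD2l uu.
have ua n k : `|(u n k : R) - a k| <= 2 * D n / K.
  apply/ler_addgt0Pr => r r0.
  have [m [/= ma nm]] := filter_ex (filterI (aP k _ r0) (Uoo _ (nbhs_infty_ge n))).
  rewrite (le_trans (ler_distD (u m k : R) _ _)) // lerD ?(ltW ma) //.
  by rewrite (le_trans _ (uu _ _ nm)) //; exact: (c0_norm_ub (u n - u m) k).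
have small (B r : R) : 0 <= B -> 0 < r -> exists n, B * D n < r.
  move=> B0 r0; exists (Num.truncn (B / r)).
  by rewrite /D ltr_pdivrMr // mulrC -ltr_pdivrMr // truncnS_gt.
have [v va] : exists v : c0 R, forall k, v k = a k.
  apply: c0_of_seq; apply/cvgrPdist_lt => r r0; have r20 : 0 < r / 2 by rewrite divr_gt0.
  have [n nr] := small (2 / K) _ (ltW (divr_gt0 (ltr0n _ 2) K0)) r20.
  have /cvgrPdist_lt/(_ _ r20) := c0_cvg (u n).
  apply: filterS => k; rewrite !sub0r !normrN => uk.
  have := ler_distD (u n k : R) 0 (a k); rewrite !sub0r !normrN.
  have := ua n k; rewrite (_ : 2 * D n / K = 2 / K * D n); last by rewrite mulrAC.
  by move: nr uk; lra.
have uv n : `|u n - v| <= 2 * D n / K.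
  by apply: c0_norm_le => k; rewrite [(u n - v) k](_ : _ = u n k - a k) ?ua // -va.
exists v => //; apply/eqP; rewrite -subr_eq0 -normr_le0; apply/ler_addgt0Pr => r r0.
have B0 : 0 <= C * (2 / K) + 1 by rewrite addr_ge0 // mulr_ge0 // divr_ge0 // ltW.
have [n nr] := small _ _ B0 r0.
have := ler_distD (c0_embed (u n)) (c0_embed v) p.
rewrite -c0_embedB add0r => /le_trans; apply; apply: ltW; apply: le_lt_trans nr.
rewrite mulrDl mul1r lerD // ?(ltW (uP n)) // (le_trans (c0_embed_le _)) //.
rewrite -mulrA ler_wpM2l // -[v - u n]opprB normrN (le_trans (uv n)) //.
by rewrite mulrAC.
Qed.

End c0_embedding.

(** [upper] holds because functionals of the unit ball are uniformly summable on the [y k], and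
    [lower] by testing with [f i]; hence [y] spans a copy of [c0]. *)
Lemma no_c0_null (R : realType) (E : banachLatticeType R)
    (Y : completeNormedModType R) (T : {linear E -> Y}) : bounded_operator T ->
  ~ contains_c0 Y -> null_on_summable T.
Proof.
move=> bT nc0 x d d0 dx; apply: contrapT => nT; apply: nc0.
have [e [c [f [e0 c_ge0 cx [f1 fe fo]]]]] := not_null_biorthogonal bT d0 dx nT.
have [C C0 Cb] := summable_functional_bound bT x.
pose y k := T (c k).
have upper (a : nat -> R) (m n : nat) (M : R) : 0 <= M ->
    (forall k, (m <= k < n)%N -> `|a k| <= M) ->
    `|\sum_(m <= k < n) a k *: y k| <= C * M.
  move=> M0 aM; have [g [g1 <-]] := norming_functional (\sum_(m <= k < n) a k *: y k).
  rewrite (le_trans (ler_norm _)) // linear_sum (le_trans (ler_norm_sum _ _ _)) //.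
  apply: (@le_trans _ _ (\sum_(m <= k < n) M * `|g (y k) : R|)).
    rewrite [leLHS]big_nat [leRHS]big_nat; apply: ler_sum => k mkn.
    by rewrite linearZ /= normrM ler_wpM2r // aM.
  rewrite -mulr_sumr mulrC ler_wpM2r // Cb // cx // iota_uniq //.
have lower (a : nat -> R) (M : R) (n i : nat) : (forall k, `|a k| <= M) ->
    (i < n)%N -> e * `|a i| <= `|\sum_(0 <= k < n) a k *: y k| + M * (e / 4).
  move=> aM iN; set S := \sum_(0 <= k < n) _.
  have M0 : 0 <= M by exact: le_trans (aM 0%N).
  have fiS : (f i S : R) = f i (a i *: y i) +
      \sum_(k <- [seq k <- index_iota 0 n | k != i]) (f i (a k *: y k) : R).
    rewrite linear_sum (bigD1_seq i) ?iota_uniq ?mem_index_iota //=.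
    by rewrite big_filter.
  have le1 : `|f i S : R| <= `|S| by [].
  have le2 : e * `|a i| <= `|f i (a i *: y i) : R|.
    by rewrite linearZ /= normrM mulrC ler_wpM2l // (le_trans (fe i)) // ler_norm.
  have le3 : `|\sum_(k <- [seq k <- index_iota 0 n | k != i]) (f i (a k *: y k) : R)|
      <= M * (e / 4).
    rewrite (le_trans (ler_norm_sum _ _ _)) //.
    apply: (@le_trans _ _ (\sum_(k <- [seq k <- index_iota 0 n | k != i])
        M * `|f i (y k) : R|)).
      by apply: ler_sum => k _; rewrite linearZ /= normrM ler_wpM2r.
    rewrite -mulr_sumr ler_wpM2l // fo ?filter_uniq ?iota_uniq //.
    by rewrite mem_filter eqxx.
  move: le1 le2 le3; rewrite fiS.
  move: (f i (a i *: y i) : R) (\sum_(k <- _) _ : R) => p q le1 le2 le3.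
  by have := ler_normB (p + q) q; rewrite addrK; lra.
pose J : {linear Defs.c0 R -> Y} := HB.pack (@c0_embed R Y y)
  (GRing.isLinear.Build R (Defs.c0 R) Y *:%R (@c0_embed R Y y)
    (c0_embed_linear C0 upper)).
exists J; split.
- exact: c0_embed_closed C0 e0 upper lower.
- by exists C => u; exact: (c0_embed_le C0 upper).
- by exists (e / 2) => [|u]; [by rewrite divr_gt0|exact: (c0_embed_ge C0 e0 upper lower)].
Qed.

(** * The four cases *)

Lemma order_weakly_compact_null (R : realType) (E : banachLatticeType R)
    (Y : completeNormedModType R) (T : {linear E -> Y}) : bounded_operator T ->
  order_weakly_compact T -> null_on_summable T.
Proof.
move=> bT wT; apply: weakly_compact_null => // x x0.
exists 1, (T @` `[0, x]); split => //; first exact: wT.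
by move=> z z0 zx; rewrite scale1r; exists z => //=; rewrite in_itv /= z0.
Qed.

Lemma weakly_compact_operator_null (R : realType) (E : banachLatticeType R)
    (Y : completeNormedModType R) (T : {linear E -> Y}) : bounded_operator T ->
  weakly_compact_operator T -> null_on_summable T.
Proof.
move=> bT wT; apply: weakly_compact_null => // x x0.
have x1 : 0 < `|x| + 1 by rewrite ltr_wpDl.
(* The factor moves [[0, x]] into the unit ball; adding 1 covers [x = 0]. *)
exists (`|x| + 1)^-1, (T @` [set z | `|z| <= 1]); split => //.
move=> z z0 zx; exists ((`|x| + 1)^-1 *: z); last by rewrite linearZ.
rewrite /= normrZ gtr0_norm ?invr_gt0 // ler_pdivrMl // mulr1.
by rewrite (le_trans (normv_ge0_le z0 zx)) // lerDl.
Qed.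

Theorem theorem2p5 (R : realType) (E : banachLatticeType R)
    (limited_intervals : forall a b : E, limited `[a, b]) :
  [/\ (* (i) *)
      forall (Y : completeNormedModType R) (T : {linear E -> Y}),
        bounded_operator T -> weakly_compact_operator T -> AM_compact T,
      (* (ii) *)
      forall (Y : completeNormedModType R) (T : {linear E -> Y}),
        bounded_operator T -> order_weakly_compact T -> AM_compact T,
      (* (iii) *)
      forall F : banachLatticeType R,
        order_continuous_norm (dual E) -> order_continuous_norm F ->
        forall T : {linear E -> F},
          bounded_operator T -> positive_operator T -> AM_compact T
      & (* (iv) *)
      KB_space (dual E) ->
      forall Y : completeNormedModType R, ~ contains_c0 Y ->
        forall T : {linear E -> Y}, bounded_operator T -> AM_compact T].
Proof.
split=> [Y T bT wT|Y T bT wT|F _ ocF T bT posT|_ Y nc0 T bT];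
  apply: null_on_summable_AM_compact => //.
- exact: weakly_compact_operator_null.
- exact: order_weakly_compact_null.
- exact: order_continuous_null.
- exact: no_c0_null.
Qed.
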